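(* Let $1\le p<2$, let $\eta>0$, and let $d\ge1$ be a fixed integer. There are constants $a=a(\eta)>0$ and $N_0=N_0(d,\eta)$ such that the following holds. If $K\subset\mathbb R^d$ is an origin-symmetric convex body, $\Lambda:=K\cap\mathbb Z^d$, and $N:=|\Lambda|\ge N_0$, then $$ d_{N^{1-a}}^{\mathbb C}\bigl(\mathcal E_\Lambda,L_p(\mathbb T^d)\bigr)\ \le\ N^{-\alpha_p+\eta},\qquad \alpha_p:=\frac1p-\frac12. $$
   Context: $\mathbb T=\mathbb R/\mathbb Z$, and $L_p(\mathbb T^d)$ is taken with respect to normalized Lebesgue measure. For a finite set $\Lambda\subset\mathbb Z^d$, $\mathcal E_\Lambda:=\{e_\lambda:\lambda\in\Lambda\}$ where $e_\lambda(x):=e^{2\pi i\langle\lambda,x\rangle}$, $x\in\mathbb T^d$. The complex Kolmogorov width, for real $n\ge0$, is $$ d_n^{\mathbb C}(\mathcal K,X):=\inf_{\dim_{\mathbb C} V\le n}\ \sup_{f\in\mathcal K}\operatorname{dist}_{X}(f,V),$$ the infimum being over complex linear subspaces $V\subset X$ of dimension at most $n$. *)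

(* Defs.v *)
From HB Require Import structures.
From mathcomp Require Import all_boot all_order all_algebra.
From mathcomp Require Export complex.
From mathcomp Require Import all_classical all_reals all_analysis.

Set Implicit Arguments.
Unset Strict Implicit.
Unset Printing Implicit Defensive.

Import Order.TTheory GRing.Theory Num.Theory.
Import numFieldNormedType.Exports.

Local Open Scope classical_set_scope.
Local Open Scope ring_scope.

Section torus.
Context {R : realType}.

Definition cons_pair d (z : measurableTypeR R * d.-tuple R) : d.+1.-tuple R :=
  [the d.+1.-tuple R of z.1 :: z.2].

Lemma measurable_cons_pair d : measurable_fun setT (@cons_pair d).
Proof. exact: measurable_cons. Qed.

HB.instance Definition _ d :=
  isMeasurableFun.Build _ _ _ _ (@cons_pair d) (@measurable_cons_pair d).

(* A function on the torus (R/Z)^d is encoded as a Z^d-periodic function on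
   R^d (d.-tuple R carries the product Borel sigma-algebra); integration against
   the normalized Lebesgue measure of the torus is integration against Lebesgue
   measure on the fundamental domain [0, 1]^d, built here as a d-fold product. *)
Fixpoint torus_measure d : probability (d.-tuple R) R :=
  match d with
  | 0 => \d_[tuple]
  | d'.+1 => distribution (uniform_prob (@ltr01 R) \x torus_measure d')%E
                          (@cons_pair d')
  end.

Definition torus_periodic d (f : d.-tuple R -> R[i]) : Prop :=
  forall (x : d.-tuple R) (k : 'rV[int]_d),
    f [tuple tnth x i + (k ord0 i)%:~R | i < d] = f x.

Definition complex_measurable d (f : d.-tuple R -> R[i]) : Prop :=
  measurable_fun setT (fun x => complex.Re (f x)) /\
  measurable_fun setT (fun x => complex.Im (f x)).

(* Normc.normc is the R-valued modulus; the norm `|z| lives in R[i]. *)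
Definition torus_Lnorm d (p : R) (f : d.-tuple R -> R[i]) : \bar R :=
  Lnorm (torus_measure d) p%:E
    (fun x => (ComplexField.Normc.normc (f x))%:E).

Definition torus_ae_eq d (f g : d.-tuple R -> R[i]) : Prop :=
  f = g %[ae torus_measure d].

(* Representatives of the elements of L_p; the elements themselves are the
   classes modulo torus_ae_eq. *)
Definition torus_Lp d (p : R) : set (d.-tuple R -> R[i]) :=
  [set f | [/\ torus_periodic f, complex_measurable f
             & (torus_Lnorm p f < +oo)%E]].

Definition lincomb d m (c : 'I_m -> R[i]) (b : 'I_m -> d.-tuple R -> R[i]) :
  d.-tuple R -> R[i] := fun x => \sum_(i < m) c i * b i x.

(* A subspace of L_p is a set of representatives stable under torus_ae_eq. *)
Definition Lp_subspace d (p : R) (V : set (d.-tuple R -> R[i])) : Prop :=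
  [/\ V `<=` torus_Lp p,
      forall f g, V f -> torus_Lp p g -> torus_ae_eq f g -> V g,
      V (fun=> 0)
    & forall (c : R[i]) f g, V f -> V g -> V (fun x => c * f x + g x)].

Definition Lp_basis d m (b : 'I_m -> d.-tuple R -> R[i])
    (V : set (d.-tuple R -> R[i])) : Prop :=
  [/\ forall i, V (b i),
      forall c, torus_ae_eq (lincomb c b) (fun=> 0) -> forall i, c i = 0
    & forall f, V f -> exists c, torus_ae_eq f (lincomb c b)].

Definition Lp_dim d (V : set (d.-tuple R -> R[i])) (m : nat) : Prop :=
  exists b : 'I_m -> d.-tuple R -> R[i], Lp_basis b V.

Definition Lp_dist d (p : R) (f : d.-tuple R -> R[i])
    (V : set (d.-tuple R -> R[i])) : \bar R :=
  ereal_inf [set torus_Lnorm p (fun x => f x - g x) | g in V].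

Definition kolmogorov_width d (n : R) (A : set (d.-tuple R -> R[i])) (p : R) :
    \bar R :=
  ereal_inf [set ereal_sup [set Lp_dist p f V | f in A] |
    V in [set V | Lp_subspace p V /\
                  exists2 m : nat, m%:R <= n & Lp_dim V m]].

Definition torus_exp d (l : 'rV[int]_d) : d.-tuple R -> R[i] := fun x =>
  let t := 2 * pi * \sum_(i < d) (l ord0 i)%:~R * tnth x i in
  (cos t +i* sin t)%C.

Definition torus_exps d (L : set 'rV[int]_d) : set (d.-tuple R -> R[i]) :=
  [set torus_exp l | l in L].

Definition convex_body d (K : set 'rV[R]_d) : Prop :=
  [/\ convex_set K, compact K & interior K !=set0].

Definition origin_symmetric d (K : set 'rV[R]_d) : Prop :=
  forall x, K x -> K (- x).

Definition lattice_points d (K : set 'rV[R]_d) : set 'rV[int]_d :=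
  [set l | K (map_mx intr l)].

End torus.

(* Main.v *)
From HB Require Import structures.
Require Import Defs.
From mathcomp Require Import all_boot all_order all_algebra.
From mathcomp Require Import all_classical all_reals all_analysis.
From mathcomp Require Import measurable_realfun ring lra zify.

(* Idea. (1) On subsets of an n-set, (-1)^|k & x| is the sum of (-2)^|t| over the
   t contained in k and x. Discard the t of size at most (1/2 - e) n and the rows
   and columns of weight at least (1/2 + e) n: this costs rank 2^((1 - c) n), and
   what remains has l^1 row sums at most 2^((1/2 + o(1)) n). The radix-2 fast
   Fourier transform carries this over to the n-th tensor power of the Fourier
   matrix of Z/2^l: up to rank 2^(ln) 2^(-cn), its rows have l^1 norm at most
   (2^(ln))^(1/2 + o(1)).
   (2) Let w_1, ..., w_n be integer vectors such that sum l_s w_s = 0 with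
   |l_s| < 2h + 1 forces l = 0. Sampling at 2^l-th roots of unity through a
   product of de la Vallee Poussin kernels in the variables <w_s, x> turns (1) into
   an approximation of the characters sum k_s w_s with |k_s| <= h. The L^1 norms of
   the kernels are read off the constant terms of positive majorants, so no change
   of variables on the torus is needed; the sup norms are trivial, and L^p follows.
   (3) A basis b_1, ..., b_d of Z^d that is reduced for the gauge of K gives such
   vectors, namely the (2h + 1)^j b_i, whose balanced digit expansions cover
   K & Z^d while (2h + 1)^n stays within a constant factor of its cardinality. *)

Set Implicit Arguments.
Unset Strict Implicit.
Unset Printing Implicit Defensive.

Import Order.TTheory GRing.Theory Num.Theory.
Import numFieldNormedType.Exports.

Local Open Scope classical_set_scope.
Local Open Scope ring_scope.

(** Since a may depend on eta alone, the base 2h + 1 and the modulus 2^l stay bounded and only the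
    number n of digits grows with N. Every loss per digit is therefore a power of N, to be beaten by
    the rank saving [tau]^n, where [tau] < 1 is fixed by eta already over Z/2. The radix-2 recursion
    keeps the same [tau] for all l, so l can be taken large afterwards. Two losses compete. Sampling
    at 2^l points serves only 2h + 1 frequencies, which costs (2^l/(2h + 1))^n in the rank and calls
    for a narrow transition band g of the kernel; the L^1 norm of the kernels costs (2^l/g)^n in the
    error and calls for a wide one. With 2^l/g = 2^v, v is chosen from [tau] so that the first loss
    stays below the saving, then l so large that 2^v is at most (2^l)^eps. As for the exponent: with
    X = 2^(ln), the error is about X^(1/2) in sup norm and X^(-1/2) in L^1, hence X^(1/2 - 1/p) in
    L^p, and X lies between N and a bounded power of N. *)

Local Notation cabs := ComplexField.Normc.normc.

(** * Low-rank approximation of Hadamard matrices *)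

Section modulus.
Context {R : realType}.
Implicit Types z : R[i].

Lemma cabs0 : cabs (0 : R[i]) = 0.
Proof. exact: ComplexField.Normc.normc0. Qed.

Lemma cabs1 : cabs (1 : R[i]) = 1.
Proof. exact: ComplexField.Normc.normc1. Qed.

Lemma cabsM z1 z2 : cabs (z1 * z2) = cabs z1 * cabs z2.
Proof. exact: ComplexField.Normc.normcM. Qed.

Lemma cabs_ge0 z : 0 <= cabs z.
Proof. by case: z => a b; exact: sqrtr_ge0. Qed.

Lemma cabsD_le z1 z2 : cabs (z1 + z2) <= cabs z1 + cabs z2.
Proof. exact: le_normcD. Qed.

Lemma cabsN z : cabs (- z) = cabs z.
Proof. exact: normcN. Qed.

Lemma cabs_sum_le (I : Type) (r : seq I) (P : pred I) (F : I -> R[i]) :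
  cabs (\sum_(i <- r | P i) F i) <= \sum_(i <- r | P i) cabs (F i).
Proof.
elim/big_ind2 : _ => [|x1 x2 y1 y2 h1 h2|//]; first by rewrite cabs0.
by apply: le_trans (cabsD_le _ _) _; rewrite lerD.
Qed.

Lemma cabs_prod (I : Type) (r : seq I) (P : pred I) (F : I -> R[i]) :
  cabs (\prod_(i <- r | P i) F i) = \prod_(i <- r | P i) cabs (F i).
Proof.
by elim/big_ind2 : _ => [|x1 x2 y1 y2 h1 h2|//]; rewrite ?cabs1 ?cabsM ?h1 ?h2.
Qed.

Lemma cabsX z n : cabs (z ^+ n) = cabs z ^+ n.
Proof. by elim: n => [|n ih]; rewrite ?expr0 ?cabs1// !exprS cabsM ih. Qed.

Lemma cabs_real (x : R) : cabs (x%:C)%C = `|x|.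
Proof. by rewrite /= expr0n addr0 sqrtr_sqr. Qed.

Lemma cabs_nat n : cabs (n%:R : R[i]) = n%:R.
Proof. by rewrite -(rmorph_nat (real_complex R)) cabs_real normr_nat. Qed.

End modulus.

Section low_rank.
Context {R : realType}.

(** Rank is stated as a factorization through a finite type, with a real bound: rows may form any
    type, and both factors are reused on the torus, [Y] for the approximating functions and [X] for
    their coefficients. *)
Definition low_rank (I J : Type) (A : I -> J -> R[i]) (r : R) : Prop :=
  exists (T : finType) (X : I -> T -> R[i]) (Y : T -> J -> R[i]),
    #|T|%:R <= r /\ forall i j, A i j = \sum_t X i t * Y t j.

(** A form of matrix rigidity in which the remainder is small in the l^1 norm of each row instead of
    being sparse. *)
Definition approximable (I : Type) (J : finType) (A : I -> J -> R[i]) (r s : R)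
    : Prop :=
  exists2 L, low_rank L r & forall i, \sum_j cabs (A i j - L i j) <= s.

Lemma low_rankW (I J : Type) (A : I -> J -> R[i]) (r r' : R) :
  r <= r' -> low_rank A r -> low_rank A r'.
Proof.
move=> rr' [T [X [Y [Tr AE]]]]; exists T, X, Y; split => //.
exact: le_trans Tr rr'.
Qed.

Lemma low_rankD (I J : Type) (A B : I -> J -> R[i]) (r r' : R) :
  low_rank A r -> low_rank B r' ->
  low_rank (fun i j => A i j + B i j) (r + r').
Proof.
move=> [T [X [Y [Tr AE]]]] [T' [X' [Y' [Tr' BE]]]].
exists (T + T')%type,
  (fun i t => match t with inl u => X i u | inr u => X' i u end),
  (fun t j => match t with inl u => Y u j | inr u => Y' u j end).
split; first by rewrite card_sum natrD lerD.
by move=> i j; rewrite big_sumType /= AE BE.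
Qed.

Lemma low_rank_sum (I J : Type) (T : finType) (P : pred T)
    (X : I -> T -> R[i]) (Y : T -> J -> R[i]) (r : R) :
  #|P|%:R <= r -> low_rank (fun i j => \sum_(t | P t) X i t * Y t j) r.
Proof.
move=> Pr; exists 'I_#|P|, (fun i t => X i (enum_val t)),
  (fun t j => Y (enum_val t) j).
split; first by rewrite card_ord.
by move=> i j; rewrite -(@big_enum_val _ _ _ _ P (fun t => X i t * Y t j)).
Qed.

Lemma low_rank_ext (I J : Type) (A B : I -> J -> R[i]) (r : R) :
  (forall i j, A i j = B i j) -> low_rank A r -> low_rank B r.
Proof.
move=> AB [T [X [Y [Tr AE]]]]; exists T, X, Y; split => // i j.
by rewrite -AB AE.
Qed.

Lemma low_rank_rows (I : finType) (J : Type) (A : I -> J -> R[i]) (P : pred I)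
    (r : R) :
  #|P|%:R <= r -> low_rank (fun i j => if P i then A i j else 0) r.
Proof.
move=> /(@low_rank_sum I J I P (fun i t => (i == t)%:R) A); apply: low_rank_ext.
move=> i j; case: ifPn => Pi.
  rewrite (bigD1 i)//= eqxx mul1r big1 ?addr0// => t /andP[_ ti].
  by rewrite eq_sym (negbTE ti) mul0r.
rewrite big1// => t Pt; case: eqP => [it|]; last by rewrite mul0r.
by move: Pi; rewrite it Pt.
Qed.

Lemma low_rank_tr (I J : Type) (A : I -> J -> R[i]) (r : R) :
  low_rank A r -> low_rank (fun j i => A i j) r.
Proof.
move=> [T [X [Y [Tr AE]]]]; exists T, (fun j t => Y t j), (fun t i => X i t).
by split => // j i; rewrite AE; apply: eq_bigr => t _; rewrite mulrC.
Qed.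

Lemma low_rank_scale (I J : Type) (A : I -> J -> R[i]) (u : I -> R[i])
    (v : J -> R[i]) (r : R) :
  low_rank A r -> low_rank (fun i j => u i * A i j * v j) r.
Proof.
move=> [T [X [Y [Tr AE]]]].
exists T, (fun i t => u i * X i t), (fun t j => Y t j * v j).
split=> // i j; rewrite AE mulr_sumr mulr_suml; apply: eq_bigr => t _.
by rewrite !mulrA.
Qed.

End low_rank.

Section subset_sums.
Import boot.fintype boot.finset.
Context {R : realType} (T : finType).
Implicit Types k x t : {set T}.

Lemma prod_if (F : comRingType) k (a b : F) :
  \prod_i (if i \in k then a else b) = a ^+ #|k| * b ^+ #|~: k|.
Proof.
rewrite (bigID (mem k))/= -!prodr_const; congr (_ * _).
  by apply: eq_bigr => i ->.
rewrite (eq_bigr (fun=> b)); last by move=> i /negbTE ->.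
by apply: eq_bigl => i; rewrite in_setC.
Qed.

Lemma prod_if1 (F : comRingType) k (a : F) :
  \prod_i (if i \in k then a else 1) = a ^+ #|k|.
Proof. by rewrite prod_if expr1n mulr1. Qed.

Lemma sum_subset_prod (F : comRingType) (f g : T -> F) :
  \sum_(t : {set T}) \prod_i (if i \in t then f i else g i) = \prod_i (f i + g i).
Proof. by rewrite bigA_distr. Qed.

Lemma sum_subset_expr (F : comRingType) k (a : F) :
  \sum_(t : {set T} | t \subset k) a ^+ #|t| = (1 + a) ^+ #|k|.
Proof.
transitivity (\prod_i ((if i \in k then a else 0) + 1)).
  rewrite -sum_subset_prod big_mkcond/=; apply: eq_bigr => t _.
  case: ifPn => [tk|/subsetPn[i it ik]].
    rewrite -prod_if1; apply: eq_bigr => i _.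
    by case: ifPn => // it; rewrite (subsetP tk _ it).
  by rewrite (bigD1 i)//= it (negbTE ik) mul0r.
rewrite -prod_if1; apply: eq_bigr => i _.
by case: ifP; rewrite ?add0r// addrC.
Qed.

Lemma sum_subset_le k (z : R) : 0 <= z ->
  \sum_(t : {set T} | t \subset k) z ^+ #|k :\: t| <= (1 + z) ^+ #|T|.
Proof.
move=> z0.
have -> : \sum_(t : {set T} | t \subset k) z ^+ #|k :\: t| =
          \prod_i ((if i \in k then 1 else 0) + (if i \in k then z else 1)).
  rewrite -sum_subset_prod big_mkcond/=; apply: eq_bigr => t _.
  case: ifPn => [tk|/subsetPn[i it ik]]; last first.
    by rewrite (bigD1 i)//= it (negbTE ik) mul0r.
  rewrite -prod_if1.
  apply: eq_bigr => i _; rewrite !inE.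
  by case: (boolP (i \in t)) => it/=; [rewrite (subsetP tk _ it)|case: ifP].
rewrite -prodr_const; apply: ler_prod => i _.
by case: ifP => _; lra.
Qed.

Lemma sum_supset_le t (z : R) : 0 <= z ->
  \sum_(x : {set T} | t \subset x) z ^+ #|x :\: t| <= (1 + z) ^+ #|T|.
Proof.
move=> z0; apply: le_trans (sum_subset_le (~: t) z0).
rewrite (reindex_inj (inv_inj (@setCK T))) le_eqVlt; apply/orP; left; apply/eqP.
apply: eq_big => x; first by rewrite -setCS setCK.
by rewrite setDE setIC -setDE.
Qed.

(** Exponential Markov inequality: each t in [P] has weight exp(mu (a - m t)) >= 1. The last
    hypothesis bounds the generating function of [m]; it is an equality when [m] is the size of t or
    of its complement. *)
Lemma card_le_chernoff (P : pred {set T}) (m : {set T} -> nat) (mu a : R) :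
  0 <= mu -> (forall t, P t -> (m t)%:R <= a) ->
  \sum_(t : {set T}) expR (- mu) ^+ m t <= (1 + expR (- mu)) ^+ #|T| ->
  #|P|%:R <= expR (mu * a) * (1 + expR (- mu)) ^+ #|T|.
Proof.
move=> mu0 Pm /(ler_wpM2l (expR_ge0 (mu * a))); apply: le_trans.
rewrite -sum1_card natr_sum mulr_sumr [leRHS](bigID P)/=.
rewrite -[leLHS]addr0 lerD//; last first.
  by apply: sumr_ge0 => t _; rewrite mulr_ge0 ?exprn_ge0 ?expR_ge0.
apply: ler_sum => t Pt; rewrite -expRM_natl -expRD -[leLHS]expR0 ler_expR.
have := Pm _ Pt; nra.
Qed.

End subset_sums.

Section hadamard.
Import boot.fintype boot.finset.
Context {R : realType}.

Definition hadamard (T : finType) (k x : {set T}) : R[i] := (-1) ^+ #|k :&: x|.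

Lemma hadamardE (T : finType) (k x : {set T}) :
  hadamard k x =
  \sum_(t : {set T} | (t \subset k) && (t \subset x)) (- 2) ^+ #|t|.
Proof.
rewrite /hadamard (_ : -1 = 1 + (- 2)); last by ring.
by rewrite -sum_subset_expr; apply: eq_bigl => t; rewrite subsetI.
Qed.

Section truncation.
Context (T : finType) (e mu : R).
Hypothesis mu0 : 0 <= mu.

Let light (t : {set T}) := #|t|%:R <= (2^-1 - e) * #|T|%:R :> R.
Let heavy (t : {set T}) := (2^-1 + e) * #|T|%:R <= #|t|%:R :> R.

(** The pieces are the heavy rows, the heavy columns on the other rows, and, on the remaining block,
    the terms of the binomial expansion with light t. The error thus lives on non-heavy k and x and
    involves only non-light t. *)
Definition hadamard_trunc (k x : {set T}) : R[i] :=
  (if heavy k then hadamard k x else 0) +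
  ((if heavy x then hadamard k x *+ ~~ heavy k else 0) +
   (~~ heavy k)%:R *
   (\sum_(t | light t) ((t \subset k)%:R * ((- 2) ^+ #|t| * (t \subset x)%:R)))
   * (~~ heavy x)%:R).

Lemma hadamard_trunc_low_rank (s : R) : 0 <= s ->
  low_rank hadamard_trunc
    (3 * (expR (s * (2^-1 - e) * #|T|%:R) * (1 + expR (- s)) ^+ #|T|)).
Proof.
move=> s0.
have card_heavy :
    #|heavy|%:R <= expR (s * (2^-1 - e) * #|T|%:R) * (1 + expR (- s)) ^+ #|T|.
  rewrite -mulrA; apply: (@card_le_chernoff R T _ (fun t => #|~: t|)) => //.
    by move=> t; rewrite /heavy => ht; rewrite cardsCs setCK natrB ?max_card//; lra.
  rewrite -(@cardsT T) -sum_subset_expr (eq_bigl _ _ (@subsetT _)).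
  rewrite [leRHS](reindex_inj (inv_inj (@setCK T)))/= le_eqVlt.
  by rewrite eqxx.
rewrite (_ : 3 * _ = expR (s * (2^-1 - e) * #|T|%:R) * (1 + expR (- s)) ^+ #|T|
  + (expR (s * (2^-1 - e) * #|T|%:R) * (1 + expR (- s)) ^+ #|T|
  + expR (s * (2^-1 - e) * #|T|%:R) * (1 + expR (- s)) ^+ #|T|)); last by ring.
apply: low_rankD; first exact: low_rank_rows.
apply: low_rankD; first by apply: low_rank_tr; exact: low_rank_rows.
apply: low_rank_scale; apply: low_rank_sum.
rewrite -mulrA; apply: (@card_le_chernoff R T _ (fun t => #|t|)) => //.
rewrite -(@cardsT T) -sum_subset_expr le_eqVlt.
by rewrite (eq_bigl _ _ (@subsetT _)) eqxx.
Qed.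

(** A surviving t has more than (1/2 - e) n points while k and x have fewer than (1/2 + e) n, so k
    and x exceed t by less than 4 e n points in total. Hence exp(mu (4 e n - |k - t| - |x - t|)) >=
    1 may be inserted; these damping factors are what later makes the sums over t and x factor over
    the points of [T]. *)
Lemma hadamard_truncB_le (k x : {set T}) :
  cabs (hadamard k x - hadamard_trunc k x) <=
  \sum_(t : {set T} | (t \subset k) && (t \subset x))
    expR (#|T|%:R * (ln 2 * (2^-1 + e) + 4 * e * mu)) *
    (expR (- mu) ^+ #|k :\: t| * expR (- mu) ^+ #|x :\: t|).
Proof.
have rhs0 : 0 <= \sum_(t : {set T} | (t \subset k) && (t \subset x))
    expR (#|T|%:R * (ln 2 * (2^-1 + e) + 4 * e * mu)) *
    (expR (- mu) ^+ #|k :\: t| * expR (- mu) ^+ #|x :\: t|).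
  by apply: sumr_ge0 => t _; rewrite !mulr_ge0 ?exprn_ge0 ?expR_ge0.
rewrite /hadamard_trunc; have [hk|hk]/= := ifPn (heavy k).
  by rewrite mulr0n if_same !mul0r !addr0 subrr cabs0.
have [hx|hx]/= := ifPn (heavy x).
  by rewrite mulr1n mulr0 addr0 add0r subrr cabs0.
rewrite mul1r mulr1 !add0r hadamardE.
rewrite [X in X - _](bigID light)/= [X in cabs (X + _ - _)](_ : _ =
  \sum_(t | light t) (t \subset k)%:R * ((- 2) ^+ #|t| * (t \subset x)%:R)).
  rewrite addrAC subrr add0r; apply: le_trans (cabs_sum_le _ _ _) _.
  rewrite [leRHS](bigID light)/= -[leLHS]add0r lerD//.
    by apply: sumr_ge0 => t _; rewrite !mulr_ge0 ?exprn_ge0 ?expR_ge0.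
  apply: ler_sum => t /andP[/andP[tk tx]].
  rewrite -ltNge => tl; move: hk hx; rewrite -!ltNge => hk hx.
  rewrite cabsX cabsN cabs_nat -!expRM_natl -!expRD -[X in X ^+ _]lnK ?posrE//.
  rewrite -expRM_natl ler_expR.
  have tk' : #|t|%:R <= #|k|%:R :> R by rewrite ler_nat subset_leq_card.
  rewrite !cardsD (setIidPr tk) (setIidPr tx).
  rewrite !natrB ?subset_leq_card//.
  have l2 : 0 <= ln 2 :> R by rewrite ln_ge0// ler1n.
  set c : R := ln 2 in l2 *.
  have : c * #|t|%:R <= c * ((2^-1 + e) * #|T|%:R).
    by rewrite ler_wpM2l// (le_trans tk')// ltW.
  have : mu * (#|k|%:R - #|t|%:R + (#|x|%:R - #|t|%:R)) <= mu * (4 * e * #|T|%:R).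
    by rewrite ler_wpM2l//; lra.
  lra.
rewrite [RHS]big_mkcond [LHS]big_mkcond/=; apply: eq_bigr => t _.
by case: (t \subset k); case: (t \subset x); case: (light t);
  rewrite ?(mul0r, mulr0, mul1r, mulr1).
Qed.

Lemma hadamard_trunc_rowsum (k : {set T}) :
  \sum_(x : {set T}) cabs (hadamard k x - hadamard_trunc k x) <=
  expR (#|T|%:R * (ln 2 * (2^-1 + e) + 4 * e * mu)) *
    ((1 + expR (- mu)) ^+ #|T| * (1 + expR (- mu)) ^+ #|T|).
Proof.
apply: (@le_trans _ _ (\sum_(t : {set T} | t \subset k)
   expR (#|T|%:R * (ln 2 * (2^-1 + e) + 4 * e * mu)) * (expR (- mu) ^+ #|k :\: t|
     * \sum_(x : {set T} | t \subset x) expR (- mu) ^+ #|x :\: t|))).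
  apply: le_trans (ler_sum _ (fun x _ => hadamard_truncB_le k x)) _.
  rewrite (exchange_big_dep (fun t : {set T} => t \subset k))/=; last by move=> x t _
      /andP[].
  apply: ler_sum => t tk; rewrite le_eqVlt; apply/orP; left; apply/eqP.
  by rewrite !mulr_sumr; apply: eq_bigl => x; rewrite tk.
rewrite -mulr_sumr ler_wpM2l ?expR_ge0//.
have z0 := @expR_ge0 R (- mu).
apply: (@le_trans _ _ (\sum_(t : {set T} | t \subset k)
    expR (- mu) ^+ #|k :\: t| * (1 + expR (- mu)) ^+ #|T|)).
  by apply: ler_sum => t _; rewrite ler_wpM2l ?exprn_ge0// sum_supset_le.
by rewrite -mulr_suml ler_wpM2r ?exprn_ge0 ?addr_ge0// sum_subset_le.
Qed.

End truncation.

(** The left side is the base exp(s (1/2 - e)) (1 + exp(-s)) of the rank bound at s = 2 e. With y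
    the square of [e], rational bounds for the exponentials reduce the claim to (1 - y) (1 + 2 y) >
    1, true for 0 < y < 1/2. *)
Lemma cosh_lt (e : R) : 0 < e -> e <= 4^-1 ->
  (expR e + expR (- e)) * expR (- (2 * e * e)) < 2.
Proof.
move=> e0 e4.
have h1 : expR e <= (1 - e)^-1.
  have e1 : 0 < 1 - e by lra.
  by rewrite -[leLHS]invrK -expRN lef_pV2 ?posrE ?expR_gt0// expR_ge1Dx.
have h2 : expR (- e) <= (1 + e)^-1.
  have e1 : 0 < 1 + e by lra.
  by rewrite expRN lef_pV2 ?posrE ?expR_gt0 ?expR_ge1Dx.
have h3 : expR (- (2 * e * e)) <= (1 + 2 * e * e)^-1.
  have e1 : 0 < 1 + 2 * e * e by nra.
  by rewrite expRN lef_pV2 ?posrE ?expR_gt0 ?expR_ge1Dx.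
have h12 : (1 - e)^-1 + (1 + e)^-1 = 2 / (1 - e * e).
  by field; apply/and3P; split; apply/eqP; nra.
apply: (@le_lt_trans _ _ (2 / (1 - e * e) * (1 + 2 * e * e)^-1)).
  by rewrite ler_pM ?addr_ge0 ?expR_ge0// -h12 lerD.
rewrite -mulrA -invfM -[ltRHS]mulr1 ltr_pM2l// -mulrA.
have : 0 < e * e by rewrite mulr_gt0.
have : e * e <= 4^-1 by nra.
set y := e * e => y4 y0; rewrite invf_lt1; nra.
Qed.

Lemma hadamard_approximable (b : R) : ln 2 / 2 < b ->
  exists tau : R, [/\ 0 < tau, tau < 1 & forall T : finType,
    approximable (@hadamard T) (3 * (2 * tau) ^+ #|T|) (expR b ^+ #|T|)].
Proof.
move=> hb.
have l2 : 0 < ln 2 :> R by rewrite ln_gt0// ltr1n.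
(* Half of the slack b - (ln 2)/2 pays for the factor (1 + y)^2 with y = exp(-mu), which fixes mu;
   the other half then pays for (ln 2 + 4 mu) e. *)
set y : R := Num.min 1 ((b - ln 2 / 2) / 4).
have y0 : 0 < y by rewrite lt_min ltr01/=; lra.
have y1 : y <= 1 by rewrite ge_min lexx.
have y2 : y <= (b - ln 2 / 2) / 4 by rewrite ge_min lexx orbT.
set mu : R := - ln y.
have mu0 : 0 <= mu by rewrite /mu oppr_ge0 ln_le0.
have emu : expR (- mu) = y by rewrite /mu opprK lnK ?posrE.
have den0 : 0 < ln 2 + 4 * mu by lra.
set e : R := Num.min 4^-1 ((b - ln 2 / 2) / 2 / (ln 2 + 4 * mu)).
have e0 : 0 < e.
  rewrite /e lt_min; apply/andP; split; first by lra.
  by rewrite !divr_gt0//; lra.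
have e4 : e <= 4^-1 by rewrite ge_min lexx.
have e2 : (ln 2 + 4 * mu) * e <= (b - ln 2 / 2) / 2.
  by rewrite mulrC -ler_pdivlMr// ge_min lexx orbT.
exists ((expR e + expR (- e)) * expR (- (2 * e * e)) / 2); split.
- by rewrite divr_gt0// mulr_gt0 ?expR_gt0// addr_gt0 ?expR_gt0.
- by rewrite ltr_pdivrMr// mul1r cosh_lt.
move=> T; exists (@hadamard_trunc T e).
  have /(hadamard_trunc_low_rank T e) : 0 <= 2 * e by lra.
  apply: low_rankW.
  rewrite [X in _ <= 3 * X ^+ _]mulrC divfK// ler_pM2l// le_eqVlt; apply/orP; left;
      apply/eqP.
  rewrite mulrC expRM_natr -exprMn; congr (_ ^+ _).
  by rewrite [LHS]mulrDl mul1r [RHS]mulrDl -!expRD; congr (expR _ + expR _); field.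
move=> k; apply: le_trans (hadamard_trunc_rowsum e mu0 k) _.
rewrite emu expRM_natl -!exprMn lerXn2r ?nnegrE ?expR_ge0//.
  by rewrite !mulr_ge0 ?expR_ge0//; lra.
have y3 : 1 + y <= expR y by exact: expR_ge1Dx.
apply: (@le_trans _ _ (expR (ln 2 * (2^-1 + e) + 4 * e * mu) * (expR y * expR y))).
  by rewrite ler_wpM2l ?expR_ge0// ler_pM//; lra.
rewrite -!expRD ler_expR; nra.
Qed.

End hadamard.

(** * Fourier matrices *)

Section cis.
Context {R : realType}.
Implicit Types t : R.

(** The basic character of R/Z; [torus_exp l x] is [cis (dot l x)] by conversion. *)
Definition cis t : R[i] := (cos (2 * pi * t) +i* sin (2 * pi * t))%C.

Lemma cisD t1 t2 : cis (t1 + t2) = cis t1 * cis t2.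
Proof. by rewrite /cis mulrDr cosD sinD; congr (_ +i* _)%C; rewrite addrC. Qed.

Lemma cis0 : cis 0 = 1.
Proof. by rewrite /cis mulr0 cos0 sin0. Qed.

Lemma cabs_cis t : cabs (cis t) = 1.
Proof. by rewrite /= cos2Dsin2 sqrtr1. Qed.

Lemma cis_neq0 t : cis t != 0.
Proof.
apply/eqP => c0; have := cabs_cis t.
by rewrite c0 cabs0 => /eqP; rewrite eq_sym oner_eq0.
Qed.

Lemma cis1 : cis 1 = 1.
Proof. by rewrite /cis mulr1 mulr_natl cos2pi sin2pi. Qed.

Lemma cis_half : cis 2^-1 = -1.
Proof.
rewrite /cis (_ : 2 * pi * 2^-1 = pi); last by field.
by rewrite cospi sinpi -[RHS]/(_ +i* _)%C oppr0.
Qed.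

Lemma cisMn t n : cis (n%:R * t) = cis t ^+ n.
Proof.
elim: n => [|n ih]; first by rewrite mul0r cis0 expr0.
by rewrite -addn1 natrD mulrDl mul1r cisD ih exprD expr1.
Qed.

Lemma cisN t : cis (- t) = (cis t)^-1.
Proof.
apply: (mulfI (cis_neq0 t)); rewrite -cisD subrr cis0 divff//.
exact: cis_neq0.
Qed.

Lemma cis_nat n : cis n%:R = 1.
Proof. by rewrite -[n%:R]mulr1 cisMn cis1 expr1n. Qed.

Lemma cis_int (z : int) : cis z%:~R = 1.
Proof.
case: z => n; first by rewrite -pmulrn cis_nat.
by rewrite NegzE mulrNz -pmulrn cisN cis_nat invr1.
Qed.

Lemma cis_sum (I : Type) (r : seq I) (P : pred I) (F : I -> R) :
  cis (\sum_(i <- r | P i) F i) = \prod_(i <- r | P i) cis (F i).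
Proof. by elim/big_rec2: _ => [|i y1 y2 _ <-]; rewrite ?cis0 ?cisD. Qed.

End cis.

Section fourier.
Import boot.fintype boot.finset.
Context {R : realType}.

Lemma approximable_reindex (I I' : Type) (J J' : finType) (f : I' -> I)
    (g : J' -> J) (A : I -> J -> R[i]) (r s : R) :
  injective g -> approximable A r s ->
  approximable (fun i j => A (f i) (g j)) r s.
Proof.
move=> ginj [L [T [X [Y [Tr LE]]]] AL].
exists (fun i j => L (f i) (g j)).
  exists T, (fun i t => X (f i) t), (fun t j => Y t (g j)).
  by split => // i j; rewrite LE.
move=> i; apply: le_trans (AL (f i)).
rewrite -(big_imset (fun j => cabs (A (f i) j - L (f i) j)))/=; last by move=> ? ? _
    _ /ginj.
rewrite big_mkcond/=; apply: ler_sum => j _.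
by case: ifP => // _; exact: cabs_ge0.
Qed.

Lemma approximable_ext (I : Type) (J : finType) (A B : I -> J -> R[i]) (r s : R) :
  (forall i j, A i j = B i j) -> approximable A r s -> approximable B r s.
Proof.
move=> AB [L Lr AL]; exists L => // i; apply: le_trans (AL i).
by rewrite le_eqVlt; apply/orP; left; apply/eqP; apply: eq_bigr => j _; rewrite AB.
Qed.

(* With [H = L_H + S_H] and [B = L_B + S_B], the product is
   [L_H B + S_H L_B + S_H S_B]. *)
Lemma approximable_twist (K J U V : finType) (H : U -> V -> R[i])
    (phi : K -> V -> R[i]) (B : K -> J -> R[i]) (rH sH rB sB : R) :
  (forall k v, cabs (phi k v) = 1) ->
  approximable H rH sH -> approximable B rB sB ->
  approximable (fun (i : K * U) (j : J * V) =>
      H i.2 j.2 * phi i.1 j.2 * B i.1 j.1)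
    (rH * #|K|%:R + #|V|%:R * rB) (sH * sB).
Proof.
move=> phi1 [LH [TH [XH [YH [rHE LHE]]]] SH] [LB [TB [XB [YB [rBE LBE]]]] SB].
exists (fun i j => LH i.2 j.2 * phi i.1 j.2 * B i.1 j.1 +
    (H i.2 j.2 - LH i.2 j.2) * phi i.1 j.2 * LB i.1 j.1).
  (* The phase couples the row part in [K] with the column part in [V]. Summing over the former for
     L_H B, over the latter for S_H L_B, makes it a scalar weight; hence the factors #|K| and #|V|
     in the rank. *)
  apply: low_rankD.
    exists (TH * K)%type, (fun i t => XH i.2 t.1 * (i.1 == t.2)%:R),
      (fun t j => YH t.1 j.2 * phi t.2 j.2 * B t.2 j.1).
    split; first by rewrite card_prod natrM ler_wpM2r.
    move=> i j; rewrite -(pair_bigA _ (fun t k => XH i.2 t * (i.1 == k)%:R *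
      (YH t j.2 * phi k j.2 * B k j.1)))/= LHE !mulr_suml.
    apply: eq_bigr => t _; rewrite (bigD1 i.1)//= eqxx mulr1 big1 ?addr0 ?mulrA//.
    by move=> k /negbTE ki; rewrite eq_sym ki mulr0 mul0r.
  exists (V * TB)%type,
    (fun i t => (H i.2 t.1 - LH i.2 t.1) * phi i.1 t.1 * XB i.1 t.2),
    (fun t j => (t.1 == j.2)%:R * YB t.2 j.1).
  split; first by rewrite card_prod natrM ler_wpM2l.
  move=> i j; rewrite -(pair_bigA _ (fun v t => (H i.2 v - LH i.2 v) * phi i.1 v *
    XB i.1 t * ((v == j.2)%:R * YB t j.1)))/= (bigD1 j.2)//= [X in _ = _ + X]big1.
    rewrite addr0 LBE mulr_sumr; apply: eq_bigr => t _.
    by rewrite eqxx mul1r !mulrA.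
  by move=> v /negbTE vj; apply: big1 => t _; rewrite vj mul0r mulr0.
move=> i.
rewrite (eq_bigr (fun j => cabs (B i.1 j.1 - LB i.1 j.1) *
    cabs (H i.2 j.2 - LH i.2 j.2))); last first.
  move=> j _; rewrite -cabsM -[RHS]mul1r -(phi1 i.1 j.2) -cabsM; congr cabs; ring.
rewrite -(pair_bigA _ (fun x v => cabs (B i.1 x - LB i.1 x) *
    cabs (H i.2 v - LH i.2 v)))/=.
under eq_bigr do rewrite -mulr_sumr.
by rewrite -mulr_suml mulrC ler_pM ?sumr_ge0// => *; exact: cabs_ge0.
Qed.

Definition fourier (l : nat) (T : finType) (k x : {ffun T -> 'I_(2 ^ l)}) : R[i] :=
  \prod_i cis ((k i)%:R * (x i)%:R / (2 ^ l)%:R).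

Lemma ltn_mod_pow2 l (i : 'I_(2 ^ l.+1)) : (i %% 2 ^ l < 2 ^ l)%N.
Proof. by rewrite ltn_mod expn_gt0. Qed.

Lemma ltn_half_pow2 l (i : 'I_(2 ^ l.+1)) : (i./2 < 2 ^ l)%N.
Proof. by rewrite ltn_half_double -mul2n -expnS. Qed.

(* Decimation in time: the top bit of [k] meets only the bottom bit of [x]. *)
Lemma fourierS l (T : finType) (k x : {ffun T -> 'I_(2 ^ l.+1)}) :
  fourier k x =
  hadamard [set i | (2 ^ l <= k i)%N] [set i | odd (x i)] *
  (\prod_i cis ((k i %% 2 ^ l)%:R * (odd (x i))%:R / (2 ^ l.+1)%:R)) *
  fourier [ffun i => Ordinal (ltn_mod_pow2 (k i))]
          [ffun i => Ordinal (ltn_half_pow2 (x i))].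
Proof.
rewrite /hadamard -prod_if1 /fourier -!big_split/=; apply: eq_bigr => i _.
rewrite !ffunE !inE/=.
have kE : nat_of_ord (k i) = ((2 ^ l <= k i) * 2 ^ l + k i %% 2 ^ l)%N.
  have ki : (k i < 2 ^ l * 2)%N by rewrite mulnC -expnS.
  have [lk|kl] := leqP (2 ^ l)%N (k i); last by rewrite modn_small.
  by rewrite -{2}(subnK lk) modnDr modn_small ?mul1n ?subnKC//; lia.
have xE := odd_double_half (x i).
have -> : (k i)%:R * (x i)%:R / (2 ^ l.+1)%:R =
   ((2 ^ l <= k i)%N && odd (x i))%:R / 2 + (k i %% 2 ^ l)%:R * (odd (x i))%:R / (2 ^
       l.+1)%:R
  + (k i %% 2 ^ l)%:R * ((x i)./2)%:R / (2 ^ l)%:R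
  + ((2 ^ l <= k i)%N * (x i)./2)%:R :> R.
  rewrite [in LHS]kE -[in LHS]xE -mulnb -muln2 !natrD !natrM !natrX exprS.
  have p0 : 2%:R ^+ l != 0 :> R by rewrite expf_neq0.
  by field.
rewrite !cisD cis_nat mulr1; congr (_ * _ * _).
by case: ifP => _; rewrite ?mul0r ?cis0// mul1r cis_half.
Qed.

Lemma card_pow2_ffun l (T : finType) :
  #|{ffun T -> 'I_(2 ^ l)}| = ((2 ^ l) ^ #|T|)%N.
Proof. by rewrite card_ffun card_ord. Qed.

(** Relative to the full dimension ranks add and row norms multiply: each of the l radix-2 levels
    contributes the proportion r / 2^n and the factor s. The relative saving of the Hadamard matrix
    therefore survives up to the factor l. *)
Lemma fourier_approximable (T : finType) (r s : R) :
  approximable (@hadamard R T) r s -> forall l,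
  approximable (@fourier l T) (l%:R * r * ((2 ^ l) ^ #|T|)%:R / (2 ^ #|T|)%:R)
    (s ^+ l).
Proof.
move=> hH; elim=> [|l ih].
  exists (fun _ _ => 0).
    exists void, (fun _ _ => 0), (fun _ _ => 0); split.
      by rewrite card_void !mul0r.
    by move=> i j; rewrite big1.
  move=> k; rewrite (eq_bigr (fun=> 1)).
    by rewrite sumr_const card_pow2_ffun expn0 exp1n expr0.
  move=> x _; rewrite subr0 cabs_prod big1// => i _; exact: cabs_cis.
have phi1 (k : {ffun T -> 'I_(2 ^ l)}) (v : {set T}) :
    cabs (\prod_i cis ((k i)%:R * (i \in v)%:R / (2 ^ l.+1)%:R : R)) = 1.
  by rewrite cabs_prod big1// => i _; exact: cabs_cis.
have := approximable_twist phi1 hH ih.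
move=> /(@approximable_reindex _ {ffun T -> 'I_(2 ^ l.+1)} _ {ffun T -> 'I_(2 ^ l.+1)}
  (fun k => ([ffun i => Ordinal (ltn_mod_pow2 (k i))], [set i | (2 ^ l <= k i)%N]))
  (fun x => ([ffun i => Ordinal (ltn_half_pow2 (x i))], [set i | odd (x i)]))).
have ginj : injective (fun x : {ffun T -> 'I_(2 ^ l.+1)} =>
    ([ffun i => Ordinal (ltn_half_pow2 (x i))], [set i | odd (x i)])).
  move=> x y [/ffunP h /setP o]; apply/ffunP => i; apply: val_inj => /=.
  have := h i; have := o i; rewrite !inE !ffunE => oi [hi].
  by rewrite -(odd_double_half (x i)) oi hi odd_double_half.
move=> /(_ ginj) {ginj}; set r' := (r in approximable _ r _).
have -> : r' = l.+1%:R * r * ((2 ^ l.+1) ^ #|T|)%:R / (2 ^ #|T|)%:R.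
  rewrite /r'.
  have p0 : 2%:R ^+ #|T| != 0 :> R by rewrite expf_neq0.
  have -> : #|{: {set T}}| = (2 ^ #|T|)%N.
    rewrite -[in RHS]cardsT -card_powerset; apply: eq_card => t.
    by rewrite [RHS]powersetE subsetT.
  rewrite card_pow2_ffun expnS expnMn -[l.+1]addn1.
  by rewrite natrD !natrM !natrX; field.
rewrite -exprS; apply: approximable_ext => k x /=.
rewrite fourierS; congr (_ * _ * _).
by apply: eq_bigr => i _; rewrite ffunE inE.
Qed.

End fourier.

(** * Integration on the torus *)

Section torus_integral.
Context {R : realType}.

Definition dot d (l : 'rV[int]_d) (x : d.-tuple R) : R :=
  \sum_(i < d) (l ord0 i)%:~R * tnth x i.

Lemma measurable_dot d (l : 'rV[int]_d) : measurable_fun setT (dot l).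
Proof.
apply: measurable_sum => i.
by apply: measurable_funM; [exact: measurable_cst|exact: measurable_tnth].
Qed.

Lemma measurable_cosr : measurable_fun setT (@cos R).
Proof. by apply: continuous_measurable_fun => x; exact: continuous_cos. Qed.

Lemma measurable_sinr : measurable_fun setT (@sin R).
Proof. by apply: continuous_measurable_fun => x; exact: continuous_sin. Qed.

Lemma measurable_Recis d (a : R) (l : 'rV[int]_d) :
  measurable_fun setT (fun x => complex.Re (cis (a + dot l x))).
Proof.
apply: (measurableT_comp measurable_cosr).
apply: measurable_funM; first exact: measurable_cst.
by apply: measurable_funD; [exact: measurable_cst|exact: measurable_dot].
Qed.

Lemma measurable_Imcis d (a : R) (l : 'rV[int]_d) :
  measurable_fun setT (fun x => complex.Im (cis (a + dot l x))).
Proof.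
apply: (measurableT_comp measurable_sinr).
apply: measurable_funM; first exact: measurable_cst.
by apply: measurable_funD; [exact: measurable_cst|exact: measurable_dot].
Qed.

(** Adding 1 keeps the integrand nonnegative, so that Tonelli's theorem serves in higher dimension
    without integrability conditions; the value 1 says that the cosine has mean zero. *)
Lemma integral_uniform_cos (a : R) (k : int) : k != 0 ->
  (\int[uniform_prob (@ltr01 R)]_t (1 + complex.Re (cis (a + k%:~R * t)))%:E = 1)%E.
Proof.
move=> k0.
have kR : k%:~R != 0 :> R by rewrite intr_eq0.
pose f (t : R) : R := 1 + cos (2 * pi * (a + k%:~R * t)).
pose F (t : R) : R := t + sin (2 * pi * (a + k%:~R * t)) / (2 * pi * k%:~R).
have pi0 : pi != 0 :> R by rewrite gt_eqF// pi_gt0.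
have dF (t : R) : is_derive t (1 : R) F (f t).
  have h : is_derive t (1 : R) (fun t : R => 2 * pi * (a + k%:~R * t)) (2 * pi * k%:~R).
    by apply: is_derive_eq; rewrite /GRing.scale/=; ring.
  rewrite /F.
  apply: is_derive_eq.
  have pk0 : 2 * pi * k%:~R != 0 :> R by rewrite !mulf_neq0.
  by rewrite /f/GRing.scale/= mulr0 add0r mulrCA mulVf ?mulr1.
have cf : continuous f.
  move=> u; apply: cvgD; first exact: cvg_cst.
  apply: continuous_comp; last exact: continuous_cos.
  apply: cvgM; first exact: cvg_cst.
  by apply: cvgD; [exact: cvg_cst|apply: cvgM; [exact: cvg_cst|exact: cvg_id]].
have cF : continuous F.
  move=> u; apply: differentiable_continuous; apply/derivable1_diffP.
  exact: ex_derive.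
rewrite integral_uniform.
- rewrite subr0 invr1 mul1e (@continuous_FTC2 _ f F)//.
  + rewrite -EFinD /F mulr0 addr0 mulr1.
    have -> : sin (2 * pi * (a + k%:~R)) = sin (2 * pi * a) :> R.
      by have := cisD a (k%:~R : R); rewrite cis_int mulr1 => -[].
    by congr (_%:E); ring.
  + exact: continuous_subspaceT.
  + split; [by move=> t _; exact: ex_derive| |].
      by apply: cvg_at_right_filter; exact: cF.
    by apply: cvg_at_left_filter; exact: cF.
  + by move=> t _; rewrite derive1E; exact: derive_val.
- apply: measurableT_comp => //.
  apply: continuous_measurable_fun; exact: cf.
- by move=> t; rewrite lee_fin /= -lerBlDl sub0r cos_geN1.
Qed.

(** The phase [a] carries the induction on d, as it absorbs the first coordinate. If the remaining
    frequency [l'] vanishes, the first entry of [l] does not and the one-dimensional case applies;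
    otherwise the inner integral is already 1. *)
Lemma integral_torus_cos d (a : R) (l : 'rV[int]_d) : l != 0 ->
  (\int[torus_measure d]_x (1 + complex.Re (cis (a + dot l x)))%:E = 1)%E.
Proof.
elim: d a l => [a l|d ih a l l0]; first by rewrite thinmx0 eqxx.
have f0 n (k : 'rV[int]_n) (b : R) x :
    (0 <= (1 + complex.Re (cis (b + dot k x)))%:E)%E.
  by rewrite lee_fin /= -lerBlDl sub0r cos_geN1.
have mf n (k : 'rV[int]_n) (b : R) :
    measurable_fun setT (fun x => (1 + complex.Re (cis (b + dot k x)))%:E).
  apply: measurableT_comp => //.
  by apply: measurable_funD; [exact: measurable_cst|exact: measurable_Recis].
pose l' : 'rV[int]_d := \row_i l ord0 (lift ord0 i).
have dotE (t : R) (x : d.-tuple R) :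
    dot l (cons_pair (t, x)) = (l ord0 ord0)%:~R * t + dot l' x.
  rewrite /dot big_ord_recl /cons_pair/= tnth0; congr (_ + _).
  by apply: eq_bigr => i _; rewrite mxE tnthS.
rewrite /= ge0_integral_distribution; last 2 first.
- exact: (mf _ l a).
- by move=> x; exact: (f0 _ l a x).
rewrite fubini_tonelli1; last 2 first.
- apply: measurableT_comp; [exact: (mf _ l a)|exact: measurable_cons_pair].
- by move=> x; exact: (f0 _ l a _).
rewrite /fubini_F /=.
have [l'0|l'0] := eqVneq l' 0.
  have l00 : l ord0 ord0 != 0.
    apply: contra l0 => /eqP h; apply/eqP/rowP => i; rewrite mxE.
    case: (unliftP ord0 i) => [j ->|-> //].
    by move/rowP: l'0 => /(_ j); rewrite !mxE.
  rewrite -[RHS](integral_uniform_cos a l00); apply: eq_integral => t _.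
  under eq_integral => x _.
    rewrite dotE l'0 (_ : dot 0 x = 0) ?addr0; last first.
      by rewrite /dot big1// => i _; rewrite mxE mul0r.
    over.
  by rewrite integral_cst//= probability_setT mule1.
under eq_integral => t _.
  under eq_integral => x _ do rewrite dotE addrA.
  rewrite ih//.
  over.
by rewrite integral_cst//= probability_setT mule1.
Qed.

End torus_integral.

(** * De la Vallee Poussin kernels *)

Section kernel.
Context {R : realType}.
Import boot.fintype boot.finset.

Lemma conj_cis (t : R) : ((cis t)^*)%C = cis (- t).
Proof. by rewrite /cis /= mulrN cosN sinN. Qed.

Lemma cis_frac_neq1 (m M : nat) : (0 < m < M)%N ->
  cis (m%:R / M%:R) != 1 :> R[i].
Proof.
move=> /andP[m0 mM]; apply/eqP => -[].
have M0 : 0 < M%:R :> R by rewrite ltr0n (leq_trans _ mM).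
have s0 : 0 < sin (pi * (m%:R / M%:R)) :> R.
  apply: sin_gt0_pi; apply/andP; split.
  - apply: mulr_gt0; first exact: pi_gt0.
    by apply: divr_gt0 => //; rewrite ltr0n.
  - rewrite gtr_pMr; last exact: pi_gt0.
    by rewrite ltr_pdivrMr// mul1r ltr_nat.
rewrite (_ : 2 * pi * _ = (pi * (m%:R / M%:R)) *+ 2); last by ring.
rewrite cos_mulr2n cos2sin2 => h _; nra.
Qed.

Lemma sum_cis (m : int) (M : nat) : (`|m| < M)%N ->
  \sum_(x < M) cis (m%:~R * x%:R / M%:R) = (if m == 0 then M%:R else 0) :> R[i].
Proof.
move=> mM; have [->|m0] := eqVneq m 0.
  rewrite (eq_bigr (fun=> 1)); first by rewrite sumr_const card_ord.
  by move=> x _; rewrite mul0r mul0r cis0.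
have M0 : M%:R != 0 :> R by rewrite pnatr_eq0 -lt0n (leq_ltn_trans _ mM).
set w : R[i] := cis (m%:~R / M%:R).
rewrite (eq_bigr (fun x : 'I_M => w ^+ x)); last first.
  by move=> x _; rewrite /w -cisMn; congr cis; ring.
have w1 : w != 1.
  rewrite /w; case: m m0 mM @w => n n0 nM.
    by rewrite -pmulrn; apply: cis_frac_neq1; rewrite nM lt0n n0.
  rewrite NegzE mulrNz -pmulrn mulNr cisN; apply: contra (@cis_frac_neq1 n.+1 M nM).
  by move=> /eqP h; rewrite -[cis _]invrK h invr1.
have := subrX1 w M; rewrite /w -cisMn mulrCA divff// mulr1 cis_int subrr.
by move=> /esym/eqP; rewrite mulf_eq0 subr_eq0 (negbTE w1) => /eqP.
Qed.

(** This count is the coefficient of frequency k in the Fejer kernel; truncated subtraction makes it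
    0 outside the support. *)
Lemma card_diff (a : nat) (k : int) :
  (\sum_(i < a) \sum_(j < a) (i%:Z - j%:Z == k)%R = a - `|k|)%N.
Proof.
have main n : (\sum_(j < a) \sum_(i < a) (nat_of_ord i == j + n) = a - n)%N.
  rewrite (eq_bigr (fun j : 'I_a => nat_of_bool (j < a - n)%N)); last first.
    move=> j _; have [jn|jn] := ltnP j (a - n)%N.
      have h : (j + n < a)%N by lia.
      rewrite (bigD1 (Ordinal h))//= eqxx big1// => i /eqP ih; apply/eqP.
      by rewrite eqb0; apply/eqP => ij; apply: ih; apply: val_inj.
    by rewrite big1// => i _; have := ltn_ord i; case: eqP; lia.
  rewrite -big_mkcond/= -(big_ord_widen _ (fun=> 1%N)) ?leq_subr//.
  by rewrite sum1_card card_ord.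
case: k => n.
  rewrite exchange_big/= -[RHS]main; apply: eq_bigr => j _; apply: eq_bigr => i _.
  by congr nat_of_bool; apply/eqP/eqP; lia.
rewrite -[RHS](main n.+1); apply: eq_bigr => j _; apply: eq_bigr => i _.
by congr nat_of_bool; apply/eqP/eqP; rewrite NegzE; lia.
Qed.

Definition fejer (a : nat) (t : R) : R := cabs (\sum_(i < a) cis (i%:R * t)) ^+ 2.

Lemma fejer_ge0 a t : 0 <= fejer a t.
Proof. exact: sqr_ge0. Qed.

Lemma fejer_le a t : fejer a t <= a%:R ^+ 2.
Proof.
rewrite lerXn2r ?nnegrE ?cabs_ge0//; apply: le_trans (cabs_sum_le _ _ _) _.
rewrite (eq_bigr (fun=> 1)) ?sumr_const ?card_ord// => i _; exact: cabs_cis.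
Qed.

Lemma fejerE a t :
  ((fejer a t)%:C)%C = \sum_(i < a) \sum_(j < a) cis ((i%:Z - j%:Z)%:~R * t).
Proof.
have -> (z : R[i]) : ((cabs z ^+ 2)%:C)%C = z * (z^*)%C.
  case: z => x y; rewrite /= sqr_sqrtr ?addr_ge0 ?sqr_ge0//.
  by apply/eqP; rewrite eq_complex/=; apply/andP; split; apply/eqP; ring.
rewrite rmorph_sum mulr_suml; apply: eq_bigr => i _.
rewrite mulr_sumr; apply: eq_bigr => j _.
rewrite [X in _ * X](_ : _ = cis (- (j%:R * t))); last exact: conj_cis.
by rewrite -cisD; congr cis; rewrite intrB -!pmulrn; ring.
Qed.

(** [fejer a] is unnormalized, with coefficients a - |k| for |k| < a. The difference therefore has
    coefficient 1 for |k| <= h and degree below h + g, while the sum [dvp_bound] is a nonnegative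
    majorant with constant term (2h + g)/g. *)
Definition dvp (h g : nat) (t : R) : R := (fejer (h + g) t - fejer h t) / g%:R.
Definition dvp_bound (h g : nat) (t : R) : R :=
  (fejer (h + g) t + fejer h t) / g%:R.

Lemma dvp_bound_ge0 h g t : 0 <= dvp_bound h g t.
Proof. by rewrite divr_ge0// addr_ge0// fejer_ge0. Qed.

Lemma dvp_le h g t : `|dvp h g t| <= dvp_bound h g t.
Proof.
rewrite normrM normfV normr_nat ler_wpM2r ?invr_ge0//.
by rewrite (le_trans (ler_normB _ _))// !ger0_norm// fejer_ge0.
Qed.

Lemma dvp_bound_le h g t : dvp_bound h g t <= (h + g + h)%:R ^+ 2 / g%:R.
Proof.
rewrite ler_wpM2r ?invr_ge0//.
apply: (@le_trans _ _ ((h + g)%:R ^+ 2 + h%:R ^+ 2)); first by rewrite lerD ?fejer_le.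
have := ler0n R h; have := ler0n R g; rewrite !natrD; nra.
Qed.

(** After expansion the frequencies met on the grid are k - (i - j), all of modulus less than [M],
    so only i - j = k survives: there is no aliasing. *)
Lemma sampling_fejer (M a : nat) (k : int) (t : R) : (a + `|k| <= M)%N ->
  \sum_(x < M) cis (k%:~R * x%:R / M%:R) * ((fejer a (t - x%:R / M%:R))%:C)%C =
  M%:R * (a - `|k|)%:R * cis (k%:~R * t).
Proof.
move=> aM; rewrite -(card_diff a k).
under eq_bigr => x _ do rewrite fejerE mulr_sumr.
rewrite exchange_big/= natr_sum mulr_sumr mulr_suml; apply: eq_bigr => i _.
under eq_bigr => x _ do rewrite mulr_sumr.
rewrite exchange_big/= natr_sum mulr_sumr mulr_suml; apply: eq_bigr => j _.
have hij : (absz (k - (i%:Z - j%:Z))%R < M)%N by have := ltn_ord i; have := ltn_ord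
    j; lia.
rewrite (eq_bigr (fun x : 'I_M => cis ((i%:Z - j%:Z)%:~R * t) *
  cis ((k - (i%:Z - j%:Z))%:~R * x%:R / M%:R))); last first.
  by move=> x _; rewrite -!cisD; congr cis; rewrite !intrB; ring.
rewrite -mulr_sumr sum_cis// subr_eq0 [k == _]eq_sym.
by case: eqP => [->|_]; rewrite ?mulr1 ?mulr0 ?mul0r// mulrC.
Qed.

Lemma sampling_dvp (h g : nat) (k : int) (t : R) : (0 < g)%N -> (`|k| <= h)%N ->
  \sum_(x < h + g + h) cis (k%:~R * x%:R / (h + g + h)%:R) *
     ((dvp h g (t - x%:R / (h + g + h)%:R))%:C)%C =
  (h + g + h)%:R * cis (k%:~R * t).
Proof.
move=> g0 kh; set M := (h + g + h)%N.
transitivity ((g%:R : R[i])^-1 * (\sum_(x < M) cis (k%:~R * x%:R / M%:R) *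
     ((fejer (h + g) (t - x%:R / M%:R))%:C)%C -
     \sum_(x < M) cis (k%:~R * x%:R / M%:R) * ((fejer h (t - x%:R / M%:R))%:C)%C)).
  rewrite -sumrB mulr_sumr; apply: eq_bigr => x _.
  rewrite /dvp rmorphM fmorphV rmorph_nat rmorphB/=; ring.
rewrite !sampling_fejer; [|lia..].
have gn0 : g%:R != 0 :> R[i] by rewrite pnatr_eq0 -lt0n.
have -> : (h + g - `|k| = g + (h - `|k|))%N by lia.
by rewrite natrD; field.
Qed.

(** The character is, up to the factor M^n, a row of the Fourier matrix applied to the family of
    kernel translates. A matrix of low rank in its place thus yields functions in a space of low
    dimension. *)
Lemma sampling_dvp_prod (T : finType) (M h g : nat) (k : T -> int) (t : T -> R) :
  M = (h + g + h)%N -> (0 < g)%N -> (forall s, `|k s| <= h)%N ->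
  \sum_(x : {ffun T -> 'I_M})
    (\prod_s cis ((k s)%:~R * (x s)%:R / M%:R)) *
    ((\prod_s dvp h g (t s - (x s)%:R / M%:R))%:C)%C =
  M%:R ^+ #|T| * cis (\sum_s (k s)%:~R * t s).
Proof.
move=> -> g0 kh; rewrite cis_sum -prodr_const -big_split/=.
rewrite (eq_bigr (fun s => \sum_(x < h + g + h)
    cis ((k s)%:~R * x%:R / (h + g + h)%:R) *
     ((dvp h g (t s - x%:R / (h + g + h)%:R))%:C)%C)); last first.
  by move=> s _; rewrite sampling_dvp.
rewrite bigA_distr_bigA/=; apply: eq_bigr => x _.
by rewrite rmorph_prod -big_split.
Qed.

End kernel.

(** * Products of kernels along dissociated frequencies *)

Section dissociated.
Context {R : realType}.

Definition dissociated d (T : finType) (q : nat) (w : T -> 'rV[int]_d) : Prop :=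
  forall l : T -> int, (forall s, `|l s| < q)%N ->
    \sum_s l s *: w s = 0 -> forall s, l s = 0.

Lemma dot_sum d (T : finType) (c : T -> int) (w : T -> 'rV[int]_d)
    (y : d.-tuple R) :
  dot (\sum_s c s *: w s) y = \sum_s (c s)%:~R * dot (w s) y.
Proof.
rewrite /dot; under [RHS]eq_bigr do rewrite mulr_sumr.
rewrite exchange_big/=; apply: eq_bigr => i _.
rewrite summxE rmorph_sum mulr_suml; apply: eq_bigr => s _.
by rewrite mxE rmorphM mulrA.
Qed.

(** Lists the exponentials of [dvp_bound] with multiplicity, so that up to 1/g all coefficients are
    1 and the constant term becomes a cardinality. *)
Definition dvp_index (h g : nat) : Type :=
  ('I_(h + g) * 'I_(h + g) + 'I_h * 'I_h)%type.
HB.instance Definition _ h g := Finite.on (dvp_index h g).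

Definition dvp_freq h g (z : dvp_index h g) : int :=
  match z with
  | inl (i, j) => i%:Z - j%:Z
  | inr (i, j) => i%:Z - j%:Z
  end.

Lemma dvp_boundE h g (t : R) : real_complex R (dvp_bound h g t) =
  g%:R^-1 * \sum_(z : dvp_index h g) cis ((dvp_freq z)%:~R * t) :> R[i].
Proof.
rewrite rmorphM rmorphD fmorphV rmorph_nat mulrC big_sumType/=; congr (_ * _).
have H a : ((fejer a t)%:C)%C =
    \sum_(p : 'I_a * 'I_a) cis ((p.1%:Z - p.2%:Z)%:~R * t) :> R[i].
  by rewrite fejerE pair_bigA.
by rewrite !H; congr (_ + _); apply: eq_bigr => -[].
Qed.

Lemma card_dvp_freq0 h g : #|[pred z : dvp_index h g | dvp_freq z == 0]| = (h + g +
    h)%N.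
Proof.
rewrite -sum1_card big_sumType/=.
have H a : (\sum_(p : 'I_a * 'I_a | (p.1%:Z - p.2%:Z == 0)%R) 1 = a)%N.
  rewrite -[RHS]subn0 -(card_diff a 0) pair_bigA big_mkcond/=.
  by apply: eq_bigr => p _; case: eqP.
transitivity (\sum_(p : 'I_(h + g) * 'I_(h + g) | (p.1%:Z - p.2%:Z == 0)%R) 1 +
  \sum_(p : 'I_h * 'I_h | (p.1%:Z - p.2%:Z == 0)%R) 1)%N; last by rewrite !H.
by congr (_ + _)%N; apply: eq_bigl => -[i j]; rewrite !inE.
Qed.

(** The source of the condition g <= h: it keeps the degree h + g - 1 within the range where
    dissociation rules out relations. *)
Lemma dvp_freq_lt h g (z : dvp_index h g) : (g <= h)%N -> (`|dvp_freq z| < 2 * h + 1)%N.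
Proof.
move=> gh; case: z => -[i j] /=; have := ltn_ord i; have := ltn_ord j; lia.
Qed.

Section product.
Context (d : nat) (T : finType) (w : T -> 'rV[int]_d) (h g : nat) (phi : T -> R).
Hypotheses (g0 : (0 < g)%N) (gh : (g <= h)%N).

Definition dvp_prod_bound (y : d.-tuple R) : R :=
  \prod_s dvp_bound h g (dot (w s) y - phi s).

Let lam (z : {ffun T -> dvp_index h g}) := \sum_s dvp_freq (z s) *: w s.
Let pha (z : {ffun T -> dvp_index h g}) := - \sum_s (dvp_freq (z s))%:~R * phi s.

Lemma dvp_prod_boundE y : dvp_prod_bound y =
  g%:R ^- #|T| * \sum_z complex.Re (cis (pha z + dot (lam z) y)).
Proof.
apply: (@complexI R); rewrite rmorph_prod/=.
under eq_bigr do rewrite dvp_boundE.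
rewrite big_split/= prodr_const bigA_distr_bigA/=.
have E (z : {ffun T -> dvp_index h g}) : \prod_s cis ((dvp_freq (z s))%:~R * (dot (w
    s) y - phi s)) =
    cis (pha z + dot (lam z) y).
  rewrite -cis_sum; congr cis; rewrite dot_sum addrC -sumrB.
  by apply: eq_bigr => s _; rewrite mulrBr.
under eq_bigr do rewrite E.
(* The product of the majorants is real, hence so is the sum of exponentials, and real parts may be
   taken termwise. *)
have : complex.Im (g%:R^-1 ^+ #|T| * \sum_z cis (pha z + dot (lam z) y) : R[i]) = 0.
  under eq_bigr do rewrite -E.
  rewrite -(bigA_distr_bigA (fun s (z : dvp_index h g) => cis ((dvp_freq z)%:~R *
      (dot (w s) y - phi s)))).
  rewrite -prodr_const -big_split/=.
  by under eq_bigr do rewrite -dvp_boundE; rewrite -rmorph_prod.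
have -> : (g%:R^-1 ^+ #|T| : R[i]) = ((g%:R^-1 ^+ #|T| : R)%:C)%C.
  by rewrite rmorphXn fmorphV rmorph_nat.
have -> : \sum_z complex.Re (cis (pha z + dot (lam z) y)) =
  complex.Re (\sum_z cis (pha z + dot (lam z) y) : R[i]) by rewrite raddf_sum.
rewrite exprVn; case: (\sum_z _) => a b /=; rewrite mul0r addr0 => b0.
by apply/eqP; rewrite eq_complex/= !mul0r subr0 addr0 b0 !eqxx.
Qed.

Lemma dvp_prod_bound_ge0 y : 0 <= dvp_prod_bound y.
Proof. by apply: prodr_ge0 => s _; exact: dvp_bound_ge0. Qed.

Lemma dvp_prod_bound_le y :
  dvp_prod_bound y <= ((h + g + h)%:R ^+ 2 / g%:R) ^+ #|T|.
Proof.
rewrite -prodr_const; apply: ler_prod => s _.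
by rewrite dvp_bound_ge0 dvp_bound_le.
Qed.

Lemma measurable_dvp_prod_bound : measurable_fun setT dvp_prod_bound.
Proof.
apply: (eq_measurable_fun (fun y =>
  g%:R ^- #|T| * \sum_z complex.Re (cis (pha z + dot (lam z) y)))).
  by move=> y _; rewrite dvp_prod_boundE.
apply: measurable_funM; first exact: measurable_cst.
by apply: measurable_sum => z; exact: measurable_Recis.
Qed.

(* By dissociation the constant term of the product is the product of the
   constant terms. *)
Lemma integral_dvp_prod_bound : dissociated (2 * h + 1) w ->
  (\int[torus_measure d]_y (dvp_prod_bound y)%:E =
   (((h + g + h)%:R / g%:R) ^+ #|T|)%:E)%E.
Proof.
move=> dis.
have G0 : 0 <= g%:R ^- #|T| :> R by rewrite invr_ge0 exprn_ge0.
have Gn0 : g%:R ^+ #|T| != 0 :> R by rewrite expf_neq0// pnatr_eq0 -lt0n.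
have mP : measurable_fun setT (EFin \o dvp_prod_bound).
  by apply: measurableT_comp => //; exact: measurable_dvp_prod_bound.
pose n := #|{ffun T -> dvp_index h g}|.
have mc z : measurable_fun setT (fun y => (1 + complex.Re (cis (pha z + dot (lam z)
    y)))%:E).
  apply: measurableT_comp => //.
  by apply: measurable_funD; [exact: measurable_cst|exact: measurable_Recis].
have c0 z (y : d.-tuple R) : (0 <= (1 + complex.Re (cis (pha z + dot (lam z) y)))%:E)%E.
  by rewrite lee_fin /= -lerBlDl sub0r cos_geN1.
(* A constant 1 is added per exponential, so that all terms 1 + cos are nonnegative and can be
   integrated one by one; the total is subtracted at the end. *)
have : (\int[torus_measure d]_y ((dvp_prod_bound y)%:E + (g%:R ^- #|T| * n%:R)%:E) =
  (g%:R ^- #|T| * n%:R)%:E + (((h + g + h)%:R / g%:R) ^+ #|T|)%:E)%E.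
  transitivity (\int[torus_measure d]_y ((g%:R ^- #|T|)%:E *
    \sum_z (1 + complex.Re (cis (pha z + dot (lam z) y)))%:E))%E.
    apply: eq_integral => y _; rewrite dvp_prod_boundE -EFinD sumEFin -EFinM.
    by rewrite big_split/= sumr_const -/n; congr (_%:E); ring.
  rewrite ge0_integralZl//; last 2 first.
  - exact: emeasurable_sum.
  - by move=> y _; apply: sume_ge0.
  rewrite ge0_integral_sum//.
  (* A term has integral 2 when all its [dvp_freq] vanish, and 1 otherwise because then [lam z] is
     nonzero. *)
  rewrite (eq_bigr (fun z : {ffun T -> dvp_index h g} => (1 + [forall s, dvp_freq (z
      s) == 0]%:R)%:E)).
    rewrite sumEFin -EFinM -EFinD big_split/= sumr_const -/n mulrDr; congr (_ + _)%:E.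
    rewrite -natr_sum expr_div_n [RHS]mulrC; congr (_ * _).
    rewrite -natrX; congr (_%:R).
    transitivity #|[pred z : {ffun T -> dvp_index h g} |
        [forall s, dvp_freq (z s) == 0]]|.
      rewrite -sum1_card [RHS]big_mkcond/=; apply: eq_bigr => z _.
      by rewrite inE; case: forallP.
    rewrite -(card_dvp_freq0 h g) -card_ffun_on; apply: eq_card => z.
    apply/idP/idP => [/forallP z0|/ffun_onP z0].
      by apply/ffun_onP => s; rewrite inE; exact: z0.
    by apply/forallP => s; have := z0 s; rewrite inE.
  move=> z _; have [/forallP z0|z0] := boolP [forall s, dvp_freq (z s) == 0].
    have l0 : lam z = 0.
      rewrite /lam big1// => s _.
      by rewrite (eqP (z0 s)) scale0r.
    have p0 : pha z = 0.
      rewrite /pha big1 ?oppr0// => s _.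
      by rewrite (eqP (z0 s)) mul0r.
    under eq_integral => y _.
      rewrite l0 p0 (_ : dot 0 y = 0); last by rewrite /dot big1// => i _; rewrite
          mxE mul0r.
      rewrite addr0 cis0.
      over.
    by rewrite integral_cst//= probability_setT mule1.
  rewrite addr0 integral_torus_cos//.
  apply: contra z0 => /eqP l0; apply/forallP => s; apply/eqP.
  by apply: (dis (fun s => dvp_freq (z s))) => // u; exact: dvp_freq_lt.
rewrite ge0_integralD//; last first.
  by move=> y _; rewrite lee_fin dvp_prod_bound_ge0.
rewrite integral_cst//= probability_setT mule1 => h1.
by rewrite -[LHS](@addeK _ (g%:R ^- #|T| * n%:R)%:E)// h1 addeAC subee ?add0e.
Qed.

End product.

Lemma measurable_cabs d (f : d.-tuple R -> R[i]) : complex_measurable f ->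
  measurable_fun setT (fun y => cabs (f y)).
Proof.
move=> [mr mi].
apply: (eq_measurable_fun (fun y => Num.sqrt (complex.Re (f y) ^+ 2 + complex.Im (f
    y) ^+ 2))).
  by move=> y _; case: (f y).
apply: (@measurableT_comp _ _ _ _ _ _ (@Num.sqrt R)).
  by apply: continuous_measurable_fun; exact: sqrt_continuous.
by apply: measurable_funD; exact: measurable_funX.
Qed.

(** Interpolation between sup norm and L^1 through a common majorant: |f|^p <= B^(p - 1) G
    pointwise. *)
Lemma torus_Lnorm_le d (p B J : R) (f : d.-tuple R -> R[i]) (G : d.-tuple R -> R) :
  1 <= p -> complex_measurable f -> measurable_fun setT G ->
  (forall y, cabs (f y) <= G y) -> (forall y, G y <= B) ->
  (\int[torus_measure d]_y (G y)%:E <= J%:E)%E ->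
  (torus_Lnorm p f <= ((B `^ (p - 1) * J) `^ p^-1)%:E)%E.
Proof.
move=> p1 [mr mi] mG fG GB GJ.
have p0 : 0 < p by lra.
have G0 y : 0 <= G y by exact: le_trans (cabs_ge0 _) (fG y).
have mf := measurable_cabs (conj mr mi).
rewrite /torus_Lnorm unlock -poweR_EFin.
have J0 : (0 <= \int[torus_measure d]_y (`|(cabs (f y))%:E| `^ p))%E.
  by apply: integral_ge0 => y _; exact: poweR_ge0.
apply: gt0_ler_poweR => //.
- by rewrite invr_ge0 ltW.
- by rewrite in_itv/= leey J0.
- rewrite in_itv/= leey lee_fin mulr_ge0 ?powR_ge0//.
  by rewrite -lee_fin (le_trans _ GJ)// integral_ge0// => y _; rewrite lee_fin.
apply: (@le_trans _ _ (\int[torus_measure d]_y ((B `^ (p - 1))%:E * (G y)%:E))%E).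
  apply: ge0_le_integral => //.
  - by move=> y _; exact: poweR_ge0.
  - apply: (eq_measurable_fun (fun y => (cabs (f y) `^ p)%:E)).
      by move=> y _; rewrite gee0_abs ?lee_fin ?cabs_ge0// poweR_EFin.
    apply: measurableT_comp => //.
    exact: (measurableT_comp (measurable_powR _)).
  - apply: measurable_funeM; exact: measurableT_comp.
  move=> y _; rewrite gee0_abs ?lee_fin ?cabs_ge0//.
  rewrite -mulr_powRB1 ?cabs_ge0// mulrC ler_pM ?powR_ge0 ?cabs_ge0//.
  apply: ge0_ler_powR; rewrite ?nnegrE ?subr_ge0 ?cabs_ge0//.
    by rewrite (le_trans (cabs_ge0 (f y)))// (le_trans (fG y)).
  exact: le_trans (fG y) (GB y).
rewrite ge0_integralZl//; last 3 first.
- exact: measurableT_comp.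
- by move=> y _; rewrite lee_fin.
- by rewrite lee_fin powR_ge0.
by rewrite EFinM lee_wpmul2l// lee_fin powR_ge0.
Qed.

End dissociated.

(** * Bounded measurable functions on the torus *)

Section torus_bounded.
Context {R : realType} (d : nat).
Implicit Types f g : d.-tuple R -> R[i].

(** A class stable under sums and products and contained in every L_p, so membership of the
    approximants needs no norm estimate. *)
Definition torus_bounded f : Prop :=
  [/\ torus_periodic f, complex_measurable f & exists B, forall y, cabs (f y) <= B].

Lemma torus_bounded_cst (c : R[i]) : torus_bounded (fun=> c).
Proof.
split; [by []|by split; exact: measurable_cst|by exists (cabs c)].
Qed.

Lemma torus_boundedD f g :
  torus_bounded f -> torus_bounded g -> torus_bounded (fun y => f y + g y).
Proof.
move=> [pf [rf jf] [B fB]] [pg [rg jg] [C gC]]; split.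
- by move=> x k; rewrite pf pg.
- split.
    rewrite (_ : (fun x => _) = (fun x => complex.Re (f x) + complex.Re (g x))).
      exact: measurable_funD.
    by apply/funext => x; rewrite raddfD.
  rewrite (_ : (fun x => _) = (fun x => complex.Im (f x) + complex.Im (g x))).
    exact: measurable_funD.
  by apply/funext => x; rewrite raddfD.
- by exists (B + C) => y; rewrite (le_trans (cabsD_le _ _))// lerD.
Qed.

Lemma torus_boundedM f g :
  torus_bounded f -> torus_bounded g -> torus_bounded (fun y => f y * g y).
Proof.
move=> [pf [rf jf] [B fB]] [pg [rg jg] [C gC]]; split.
- by move=> x k; rewrite pf pg.
- split.
    rewrite (_ : (fun x => _) = (fun x => complex.Re (f x) * complex.Re (g x) -
        complex.Im (f x) * complex.Im (g x))).
      by apply: measurable_funB; exact: measurable_funM.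
    by apply/funext => x; case: (f x) (g x) => [? ?] [? ?].
  rewrite (_ : (fun x => _) = (fun x => complex.Re (f x) * complex.Im (g x) +
      complex.Im (f x) * complex.Re (g x))).
    by apply: measurable_funD; exact: measurable_funM.
  by apply/funext => x; case: (f x) (g x) => [? ?] [? ?].
- by exists (B * C) => y; rewrite cabsM ler_pM ?cabs_ge0.
Qed.

Lemma torus_bounded_sum (I : Type) (r : seq I) (P : pred I)
    (F : I -> d.-tuple R -> R[i]) :
  (forall i, torus_bounded (F i)) ->
  torus_bounded (fun y => \sum_(i <- r | P i) F i y).
Proof.
move=> hF; elim: r => [|i r ih].
  by under eq_fun do rewrite big_nil; exact: torus_bounded_cst.
under eq_fun do rewrite big_cons.
by case: (P i) => //; exact: torus_boundedD.
Qed.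

Lemma torus_bounded_prod (I : Type) (r : seq I) (P : pred I)
    (F : I -> d.-tuple R -> R[i]) :
  (forall i, torus_bounded (F i)) ->
  torus_bounded (fun y => \prod_(i <- r | P i) F i y).
Proof.
move=> hF; elim: r => [|i r ih].
  by under eq_fun do rewrite big_nil; exact: torus_bounded_cst.
under eq_fun do rewrite big_cons.
by case: (P i) => //; exact: torus_boundedM.
Qed.

Lemma torus_bounded_cis (a : R) (l : 'rV[int]_d) :
  torus_bounded (fun y => cis (a + dot l y)).
Proof.
split.
- move=> x k; rewrite [X in a + X](_ : _ = dot l x + (\sum_i l ord0 i * k ord0 i)%:~R).
    by rewrite addrA [LHS]cisD cis_int mulr1.
  rewrite /dot rmorph_sum/= -big_split/=; apply: eq_bigr => i _ /=.
  by rewrite tnth_mktuple rmorphM mulrDr.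
- by split; [exact: measurable_Recis|exact: measurable_Imcis].
- by exists 1 => y; rewrite cabs_cis.
Qed.

Lemma torus_bounded_lincomb m (c : 'I_m -> R[i]) (b : 'I_m -> d.-tuple R -> R[i]) :
  (forall i, torus_bounded (b i)) -> torus_bounded (lincomb c b).
Proof.
move=> hb; apply: torus_bounded_sum => i.
by apply: torus_boundedM => //; exact: torus_bounded_cst.
Qed.

Lemma torus_bounded_dvp (h g : nat) (phi : R) (l : 'rV[int]_d) :
  torus_bounded (fun y => real_complex R (dvp h g (dot l y - phi))).
Proof.
have hf a : torus_bounded (fun y => real_complex R (fejer a (dot l y - phi))).
  under eq_fun do rewrite fejerE.
  apply: torus_bounded_sum => i; apply: torus_bounded_sum => j.
  have := torus_bounded_cis (- ((i%:Z - j%:Z)%:~R * phi)) ((i%:Z - j%:Z) *: l).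
  congr torus_bounded; apply/funext => y; congr cis.
  rewrite mulrBr addrC; congr (_ - _).
  rewrite /dot mulr_sumr; apply: eq_bigr => u _.
  by rewrite mxE rmorphM mulrA.
rewrite (_ : (fun y => _) = fun y => g%:R^-1 * (real_complex R (fejer (h + g) (dot l
    y - phi)) +
   -1 * real_complex R (fejer h (dot l y - phi)))); last first.
  by apply/funext => y; rewrite rmorphM fmorphV rmorph_nat rmorphB mulrC mulN1r.
apply: torus_boundedM; first exact: torus_bounded_cst.
by apply: torus_boundedD => //; apply: torus_boundedM => //; exact: torus_bounded_cst.
Qed.

Lemma torus_bounded_Lp (p : R) f : 1 <= p -> torus_bounded f -> torus_Lp p f.
Proof.
move=> p1 [pf mf [B fB]]; split => //.
apply: (le_lt_trans (@torus_Lnorm_le R d p B B f (fun=> B) p1 mf _ fB _ _)).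
- exact: measurable_cst.
- by [].
- by rewrite integral_cst//= probability_setT mule1.
- by rewrite ltry.
Qed.

End torus_bounded.

(** * From Fourier matrices to characters *)

Section torus_approximation.
Context {R : realType}.

Lemma ltn_modz_pow2 (k : int) l : (`|(k %% (2 ^ l)%N%:Z)%Z| < 2 ^ l)%N.
Proof.
have h : (0 < (2 ^ l)%N%:Z)%R by rewrite ltz_nat expn_gt0.
have := ltz_pmod k h; have := modz_ge0 k (lt0r_neq0 h); lia.
Qed.

(** On 2^l-th roots of unity a character depends on its frequency modulo 2^l only, so negative
    digits select a row of [fourier] as well. *)
Lemma fourier_mod l (T : finType) (k : T -> int) (x : {ffun T -> 'I_(2 ^ l)}) :
  \prod_s cis ((k s)%:~R * (x s)%:R / (2 ^ l)%:R) =
  fourier [ffun s => Ordinal (ltn_modz_pow2 (k s) l)] x :> R[i].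
Proof.
apply: eq_bigr => s _; rewrite ffunE/=.
set q := (k s %/ (2 ^ l)%N%:Z)%Z; set m := (k s %% (2 ^ l)%N%:Z)%Z.
have m0 : 0 <= m by rewrite modz_ge0// gt_eqF// ltz_nat expn_gt0.
have p0 : (2 ^ l)%:R != 0 :> R by rewrite natrX expf_neq0.
have kE : (k s)%:~R = q%:~R * (2 ^ l)%:R + (`|m|%N)%:R :> R.
  have -> : (`|m|%N)%:R = m%:~R :> R by rewrite pmulrn gez0_abs.
  by rewrite {1}(divz_eq (k s) (2 ^ l)%N%:Z) intrD intrM -pmulrn.
have -> : (k s)%:~R * (x s)%:R / (2 ^ l)%:R =
    (q * (x s)%:Z)%:~R + (`|m|%N)%:R * (x s)%:R / (2 ^ l)%:R :> R.
  by rewrite kE intrM -pmulrn; field.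
by rewrite cisD cis_int mul1r.
Qed.

(** Put M = 2^l and n = #|T|. Replacing the Fourier matrix by its low-rank part in the sampling
    identity leaves the error M^-n times a row of the remainder applied to the kernel products. With
    A = s (M/g)^n, a majorant of it is at most A and has integral at most M^-n A; interpolation
    gives A M^(-n/p). The coefficients [c] are the same for all p. *)
Lemma torus_approximation d (T : finType) (w : T -> 'rV[int]_d) (l h g : nat)
    (r s : R) :
  (0 < g)%N -> (g <= h)%N -> (2 ^ l = h + g + h)%N -> dissociated (2 * h + 1) w ->
  approximable (@fourier R l T) r s ->
  exists (m : nat) (b : 'I_m -> d.-tuple R -> R[i]),
    [/\ m%:R <= r, forall i, torus_bounded (b i) &
     forall k, (forall t, `|k t| <= h)%N -> exists c, forall p, 1 <= p ->
      (torus_Lnorm p (fun y => torus_exp (\sum_t k t *: w t) y - lincomb c b y)%R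
       <= (s * ((2 ^ l)%:R / g%:R) ^+ #|T| *
           ((2 ^ l)%:R ^+ #|T|) `^ (- p^-1))%:E)%E].
Proof.
move=> g0 gh Ml dis [L [U [X' [Y' [Ur LE']]]] AL].
pose X i (u : 'I_#|U|) := X' i (enum_val u).
pose Y (u : 'I_#|U|) j := Y' (enum_val u) j.
have LE i j : L i j = \sum_u X i u * Y u j.
  by rewrite LE' (reindex (@enum_val U predT))//; exact/onW_bij/enum_val_bij.
move: X Y LE {LE'} => X Y LE.
set M := (2 ^ l)%N in Ml *; set n := #|T|.
have M0 : 0 < M%:R :> R by rewrite ltr0n expn_gt0.
have gR : 0 < g%:R :> R by rewrite ltr0n.
pose D (x : {ffun T -> 'I_M}) (y : d.-tuple R) : R[i] :=
  real_complex R (\prod_t dvp h g (dot (w t) y - (x t)%:R / M%:R)).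
pose P (x : {ffun T -> 'I_M}) : d.-tuple R -> R := dvp_prod_bound w h g (fun t => (x
    t)%:R / M%:R).
have DP x y : cabs (D x y) <= P x y.
  rewrite /D cabs_real normr_prod; apply: ler_prod => t _.
  by rewrite normr_ge0 dvp_le.
exists #|U|, (fun i y => \sum_x Y i x * D x y); split => //.
  move=> i; apply: torus_bounded_sum => x; apply: torus_boundedM.
    exact: torus_bounded_cst.
  have -> : D x = fun y => \prod_t real_complex R (dvp h g (dot (w t) y - (x t)%:R /
      M%:R)).
    by apply/funext => y; rewrite /D rmorph_prod.
  by apply: torus_bounded_prod => t; exact: torus_bounded_dvp.
move=> k kh; pose K := [ffun t => Ordinal (ltn_modz_pow2 (k t) l)].
exists (fun i => M%:R ^- n * X K i) => p p1.
have Mn0 : M%:R ^+ n != 0 :> R[i].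
  by rewrite expf_neq0// pnatr_eq0 -lt0n expn_gt0.
have E y : torus_exp (\sum_t k t *: w t) y -
    lincomb (fun i => M%:R ^- n * X K i)
      (fun i y => \sum_x Y i x * D x y) y =
    M%:R ^- n * \sum_x (fourier K x - L K x) * D x y.
  have -> : torus_exp (\sum_t k t *: w t) y =
      M%:R ^- n * \sum_x fourier K x * D x y.
    apply: (mulfI Mn0); rewrite mulrA divff// mul1r.
    rewrite -[torus_exp _ _]/(cis (dot _ y)) dot_sum.
    rewrite -(sampling_dvp_prod _ Ml g0 kh); apply: eq_bigr => x _.
    by rewrite fourier_mod.
  rewrite /lincomb.
  under [X in _ - X]eq_bigr => u _ do rewrite -mulrA mulr_sumr.
  rewrite -mulr_sumr exchange_big/= -mulrBr -sumrB; congr (_ * _).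
  apply: eq_bigr => x _; rewrite mulrBl LE mulr_suml; congr (_ - _).
  by apply: eq_bigr => u _; rewrite mulrA.
pose a x := cabs (fourier K x - L K x).
have a0 x : 0 <= a x by exact: cabs_ge0.
pose G y := M%:R ^- n * \sum_x a x * P x y.
have Mi0 : 0 <= M%:R ^- n :> R by rewrite invr_ge0 exprn_ge0// ltW.
have s0 : 0 <= s.
  by apply: (le_trans _ (AL K)); apply: sumr_ge0 => x _; exact: cabs_ge0.
pose A := s * (M%:R / g%:R) ^+ n.
have A0 : 0 <= A by rewrite mulr_ge0// exprn_ge0// divr_ge0// ltW.
have mPx x : measurable_fun setT (P x) by exact: measurable_dvp_prod_bound.
have Px0 x y : 0 <= P x y by exact: dvp_prod_bound_ge0.
apply: le_trans (@torus_Lnorm_le R d p A (M%:R ^- n * A) _ G p1 _ _ _ _ _) _.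
- have [_ mE _] : torus_bounded (fun y => M%:R ^- n * \sum_x (fourier K x - L K x) *
    D x y).
    apply: torus_boundedM; first exact: torus_bounded_cst.
    apply: torus_bounded_sum => x; apply: torus_boundedM; first exact:
        torus_bounded_cst.
    have -> : D x = fun y => \prod_t real_complex R (dvp h g (dot (w t) y - (x t)%:R
        / M%:R)).
      by apply/funext => y; rewrite /D rmorph_prod.
    by apply: torus_bounded_prod => t; exact: torus_bounded_dvp.
  by under eq_fun do rewrite E.
- apply: measurable_funM; first exact: measurable_cst.
  apply: measurable_sum => x; apply: measurable_funM; first exact: measurable_cst.
  exact: mPx.
- move=> y; rewrite E cabsM ComplexField.Normc.normcV cabsX cabs_nat ler_wpM2l//.
  apply: le_trans (cabs_sum_le _ _ _) _; apply: ler_sum => x _.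
  by rewrite cabsM; apply: ler_wpM2l; [exact: (a0 x)|exact: DP].
- move=> y; rewrite /G /A.
  have -> : s * (M%:R / g%:R) ^+ n = M%:R ^- n * (s * (M%:R ^+ 2 / g%:R) ^+ n).
    rewrite mulrCA; congr (_ * _); rewrite -exprVn -exprMn; congr (_ ^+ _).
    by field; rewrite !gt_eqF.
  rewrite ler_wpM2l// (@le_trans _ _ (\sum_x a x * (M%:R ^+ 2 / g%:R) ^+ n))//.
    apply: ler_sum => x _; rewrite ler_wpM2l// Ml.
    exact: dvp_prod_bound_le.
  rewrite -mulr_suml; apply: ler_wpM2r; last exact: AL.
  by rewrite exprn_ge0// divr_ge0// exprn_ge0// ltW.
- rewrite (eq_integral (fun y => (M%:R ^- n)%:E * \sum_x (a x)%:E * (P x y)%:E)%E);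
    last first.
    by move=> y _; rewrite /G EFinM -sumEFin.
  have mterm x : measurable_fun setT (fun y => (a x)%:E * (P x y)%:E)%E.
    by apply: measurable_funeM; apply: measurableT_comp.
  have term0 x y : (0 <= (a x)%:E * (P x y)%:E)%E by rewrite mule_ge0// lee_fin.
  rewrite ge0_integralZl//; last 2 first.
  - exact: emeasurable_sum.
  - by move=> y _; apply: sume_ge0.
  rewrite EFinM lee_wpmul2l// ge0_integral_sum//.
  rewrite (eq_bigr (fun x => (a x * (M%:R / g%:R) ^+ n)%:E)); last first.
    move=> x _; rewrite ge0_integralZl//; last 3 first.
    - by apply: measurableT_comp.
    - by move=> y _; rewrite lee_fin.
    - by rewrite lee_fin.
    by rewrite integral_dvp_prod_bound// -Ml EFinM.
  rewrite sumEFin lee_fin -mulr_suml; apply: ler_wpM2r; last exact: AL.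
  by rewrite exprn_ge0// divr_ge0// ltW.
rewrite lee_fin mulrCA [A `^ _ * A]mulrC mulr_powRB1//; last by lra.
rewrite powRM// ?powR_ge0// -powRrM mulfV ?gt_eqF//; last by lra.
rewrite powRr1// mulrC -powR_inv1 ?exprn_ge0//.
by rewrite -powRrM mulN1r.
Qed.

End torus_approximation.

(** * Reduced bases *)

Section reduced_basis.
Context {R : realType}.

(** The last clause is definiteness in quantitative form: it bounds the length of nonzero integer
    vectors from below and passes to quotients. Equality in the homogeneity clause is derived in
    [is_normZ]. *)
Definition is_norm d (rho : 'rV[R]_d -> R) : Prop :=
  [/\ forall x y, rho (x + y) <= rho x + rho y,
      forall a (x : 'rV[R]_d), rho (a *: x) <= `|a| * rho x &
      exists2 c : R, 0 < c & forall (x : 'rV[R]_d) i, c * `|x ord0 i| <= rho x].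

Definition int_vec d (l : 'rV[int]_d) : 'rV[R]_d := map_mx intr l.

Section norm_theory.
Context d (rho : 'rV[R]_d -> R).
Hypothesis hrho : is_norm rho.

Lemma is_norm_ge0 x : 0 <= rho x.
Proof.
case: hrho => tri hom _.
have h0 : 0 <= rho 0 by have := tri 0 0; rewrite addr0; lra.
have := tri x (- x); rewrite subrr; have := hom (-1) x.
rewrite scaleN1r normrN1 mul1r; lra.
Qed.

Lemma is_norm0 : rho 0 = 0.
Proof.
case: hrho => tri hom _; apply/eqP; rewrite eq_le is_norm_ge0 andbT.
by have := hom 0 0; rewrite scaler0 normr0 mul0r.
Qed.

Lemma is_normZ a x : rho (a *: x) = `|a| * rho x.
Proof.
case: hrho => tri hom _; have [->|a0] := eqVneq a 0.
  by rewrite scale0r is_norm0 normr0 mul0r.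
apply/eqP; rewrite eq_le hom/=.
have := hom a^-1 (a *: x); rewrite scalerA mulVf// scale1r normfV.
by rewrite mulrC ler_pdivlMr ?normr_gt0// mulrC.
Qed.

Lemma is_normB_le x y : rho (x - y) <= rho x + rho y.
Proof.
case: hrho => tri hom _; apply: le_trans (tri _ _) _.
by rewrite lerD2l -scaleN1r is_normZ normrN1 mul1r.
Qed.

Lemma is_norm_sum_le (I : Type) (r : seq I) (P : pred I) (F : I -> 'rV[R]_d) :
  rho (\sum_(i <- r | P i) F i) <= \sum_(i <- r | P i) rho (F i).
Proof.
case: hrho => tri _ _.
elim/big_ind2 : _ => [|x1 x2 y1 y2 h1 h2|//]; first by rewrite is_norm0.
by apply: le_trans (tri _ _) _; rewrite lerD.
Qed.

Lemma is_norm_int_vec_ge : exists2 c, 0 < c & forall l : 'rV[int]_d, l != 0 -> c <=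
    rho (int_vec l).
Proof.
case: hrho => _ _ [c c0 hc]; exists c => // l l0.
have [i li] : exists i, l ord0 i != 0.
  apply/existsP; apply: contraR l0; rewrite negb_exists => /forallP h.
  by apply/eqP/rowP => i; rewrite mxE; apply/eqP; have := h i; rewrite negbK.
apply: le_trans (hc _ i); rewrite -[leLHS]mulr1 ler_pM2l// mxE -intr_norm.
by rewrite -[1]/(1%:~R) ler_int; lia.
Qed.

(** A vector within half the infimum of the infimum is enough, which spares a proof that the minimum
    is attained. *)
Lemma almost_shortest : (0 < d)%N -> exists2 u : 'rV[int]_d, u != 0 &
  forall l : 'rV[int]_d, l != 0 -> rho (int_vec u) <= 3 / 2 * rho (int_vec l).
Proof.
move=> d0; have [c c0 hc] := is_norm_int_vec_ge.
pose E := [set rho (int_vec l) | l in [set l : 'rV[int]_d | l != 0]].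
have E0 : E !=set0.
  exists (rho (int_vec (const_mx 1))), (const_mx 1) => //=.
  by apply/eqP => /rowP /(_ (Ordinal d0)); rewrite !mxE.
have Elb : has_lbound E by exists c => _ [l l0 <-]; exact: hc.
have Ec : c <= inf E by apply: lb_le_inf => // _ [l l0 <-]; exact: hc.
have i0 : 0 < inf E / 2 by lra.
have [_ [u u0 <-] uE] := inf_adherent i0 (conj E0 Elb).
exists u => // l l0; have : inf E <= rho (int_vec l) by apply: ge_inf => //; exists l.
lra.
Qed.

End norm_theory.

Lemma int_vecM d1 d2 (l : 'rV[int]_d1) (B : 'M[int]_(d1, d2)) :
  int_vec (l *m B) = int_vec l *m map_mx intr B.
Proof. exact: map_mxM. Qed.

(** Smith normal form of a single row completes the primitive vector in the direction of u to a
    basis of the lattice, the rows of [S]. *)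
Lemma primitive_row d (u : 'rV[int]_(1 + d)) : u != 0 ->
  exists2 S : 'M[int]_(1 + d), S \in unitmx &
  exists2 z : int, z != 0 & u = z *: row ord0 S.
Proof.
move=> u0; have [L _ [S uS [s _ uE]]] := int_Smith_normal_form u.
have uE' : u = (L ord0 ord0 * s`_0) *: row ord0 S.
  rewrite [LHS]uE; apply/rowP => j.
  rewrite !mxE (bigD1 ord0)//= [X in _ + X]big1 ?addr0; last first.
    move=> i i0; rewrite !mxE big1 ?mul0r// => k _.
    rewrite !mxE !ord1; case: eqP => [k0|_]; last by rewrite mulr0n mulr0.
    by case/eqP: i0; apply: val_inj; rewrite /= -k0.
  by rewrite !mxE big_ord1 !mxE eqxx mulr1n.
exists S => //; exists (L ord0 ord0 * s`_0) => //.
by apply: contra u0 => /eqP z0; rewrite uE' z0 scale0r.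
Qed.

Section quotient_norm.
Context d (rho : 'rV[R]_(1 + d) -> R) (S : 'M[int]_(1 + d)).
Hypotheses (hrho : is_norm rho) (uS : S \in unitmx).

Definition line_lift (t : R) (y : 'rV[R]_d) : 'rV[R]_(1 + d) :=
  row_mx t%:M y *m map_mx intr S.

(* The norm induced on the quotient by the line spanned by the first row of [S],
   in the coordinates given by the other rows. *)
Definition quotient_norm (y : 'rV[R]_d) : R :=
  inf (range (fun t => rho (line_lift t y))).

Lemma line_liftD t1 t2 y1 y2 :
  line_lift (t1 + t2) (y1 + y2) = line_lift t1 y1 + line_lift t2 y2.
Proof. by rewrite /line_lift raddfD/= -add_row_mx mulmxDl. Qed.

Lemma line_liftZ a t y : line_lift (a * t) (a *: y) = a *: line_lift t y.
Proof. by rewrite /line_lift scalemxAl scale_row_mx scale_scalar_mx. Qed.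

Lemma line_lift0 t : line_lift t 0 = t *: int_vec (row ord0 S).
Proof.
rewrite -[t in LHS]mulr1 -[0 in LHS](scaler0 _ t) line_liftZ; congr (_ *: _).
rewrite /line_lift -[map_mx _ S]vsubmxK mul_row_col mul0mx addr0 mul1mx.
by apply/rowP => j; rewrite !mxE; congr ((S _ _)%:~R); apply: val_inj.
Qed.

Lemma quotient_norm_le t y : quotient_norm y <= rho (line_lift t y).
Proof.
apply: ge_inf; last by exists t.
by exists 0 => _ [u _ <-]; exact: is_norm_ge0.
Qed.

Lemma quotient_norm_lift y e : 0 < e ->
  exists t, rho (line_lift t y) < quotient_norm y + e.
Proof.
move=> e0; pose E := range (fun t => rho (line_lift t y)).
have hE : has_inf E.
  split; first by exists (rho (line_lift 0 y)), 0.
  by exists 0 => _ [u _ <-]; exact: is_norm_ge0.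
by have [_ [t _ <-] ht] := inf_adherent e0 hE; exists t.
Qed.

(** For the coordinate bound, y is read off from any of its lifts by the inverse of [S], so the
    constant does not depend on the position t along the line. *)
Lemma quotient_is_norm : is_norm quotient_norm.
Proof.
have [tri hom [c c0 hc]] := hrho; split.
- move=> x y; apply/ler_addgt0Pr => e e0; have e2 : 0 < e / 2 by lra.
  have [t ht] := quotient_norm_lift x e2; have [u hu] := quotient_norm_lift y e2.
  have := quotient_norm_le (t + u) (x + y); rewrite line_liftD.
  have := tri (line_lift t x) (line_lift u y); lra.
- move=> a x; apply/ler_addgt0Pr => e e0.
  have a1 : 0 < `|a| + 1 by rewrite ltr_wpDl.
  have [t ht] := quotient_norm_lift x (divr_gt0 e0 a1).
  have := quotient_norm_le (a * t) (a *: x); rewrite line_liftZ => h.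
  apply: le_trans h _; apply: le_trans (hom _ _) _.
  apply: (@le_trans _ _ (`|a| * (quotient_norm x + e / (`|a| + 1)))).
    by rewrite ler_wpM2l// ltW.
  rewrite mulrDr lerD2l mulrA ler_pdivrMr// mulrC ler_wpM2l ?ltW//; lra.
- pose S' : 'M[R]_(1 + d) := map_mx intr (invmx S).
  have SS' : map_mx intr S *m S' = 1%:M by rewrite -map_mxM mulmxV// map_mx1.
  pose C := 1 + \sum_i \sum_j `|S' i j|.
  have C1 : 0 < C.
    rewrite ltr_pwDl//; apply: sumr_ge0 => i _.
    by apply: sumr_ge0 => j _.
  exists (c / C); first by rewrite divr_gt0.
  move=> y i; apply: lb_le_inf; first by exists (rho (line_lift 0 y)), 0.
  move=> _ [t _ <-]; set x := line_lift t y.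
  have yE : y ord0 i = \sum_j x ord0 j * S' j (rshift 1 i).
    have : x *m S' = row_mx t%:M y by rewrite /x /line_lift -mulmxA SS' mulmx1.
    by move=> /rowP /(_ (rshift 1 i)); rewrite mxE row_mxEr => <-.
  rewrite mulrAC ler_pdivrMr// yE.
  apply: (@le_trans _ _ (\sum_j rho x * `|S' j (rshift 1 i)|)).
    apply: (@le_trans _ _ (\sum_j c * `|x ord0 j| * `|S' j (rshift 1 i)|)).
      under [leRHS]eq_bigr do rewrite -mulrA -normrM.
      by rewrite -mulr_sumr ler_pM2l// ler_norm_sum.
    by apply: ler_sum => j _; rewrite ler_wpM2r.
  rewrite -mulr_sumr ler_wpM2l ?is_norm_ge0// ler_wpDl//.
  apply: ler_sum => j _; rewrite (bigD1 (rshift 1 i))//= lerDl.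
  exact: sumr_ge0.
Qed.

End quotient_norm.

(** The last clause is quantitative near-orthogonality: no cancellation can make a combination much
    shorter than one of its terms. *)
Definition reduced d (k : R) (rho : 'rV[R]_d -> R) (B : 'M[int]_d) : Prop :=
  [/\ forall l : 'rV[int]_d, exists n : 'rV[int]_d, l = n *m B,
      forall i, 0 < rho (int_vec (row i B)) &
      forall (n : 'rV[int]_d) i,
        k * `|(n ord0 i)%:~R| * rho (int_vec (row i B)) <= rho (int_vec (n *m B))].

(** The basis consists of the almost shortest vector v and of lifts of a reduced basis of the
    quotient, chosen short along v. Coefficients of the lifts are controlled in the quotient, the
    one of v by the triangle inequality. *)
Lemma reduced_basis_step d (k : R) (rho : 'rV[R]_(1 + d) -> R) (S : 'M[int]_(1 + d))
    (B' : 'M[int]_d) :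
  0 < k -> is_norm rho -> S \in unitmx ->
  (forall l : 'rV[int]_(1 + d), l != 0 ->
     rho (int_vec (row ord0 S)) <= 3 / 2 * rho (int_vec l)) ->
  reduced k (quotient_norm rho S) B' ->
  exists B, reduced (k / 8 / (k / 8 + d%:R + 1)) rho B.
Proof.
move=> k0 hrho uS hS [B's B'0 B'k].
set v := row ord0 S in hS *.
have v0 : 0 < rho (int_vec v).
  have [c c0 hc] := is_norm_int_vec_ge hrho.
  apply: lt_le_trans c0 (hc _ _); apply/eqP => vE.
  have : row ord0 (S *m invmx S) = 0 by rewrite row_mul -/v vE mul0mx.
  by rewrite mulmxV// => /rowP /(_ ord0); rewrite !mxE eqxx.
pose q := quotient_norm rho S.
have hlift (i : 'I_d) : exists z : int,
    rho (line_lift S z%:~R (int_vec (row i B'))) <=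
    q (int_vec (row i B')) + 7 / 12 * rho (int_vec v).
  have e0 : 0 < rho (int_vec v) / 12 by lra.
  have [t ht] := quotient_norm_lift S hrho (int_vec (row i B')) e0.
  (* Rounding t to a nearest integer costs half of the length of v, the choice of t another twelfth:
     together 7/12. *)
  pose z := Num.floor (t + 2^-1); exists z.
  have -> : line_lift S z%:~R (int_vec (row i B')) =
      line_lift S t (int_vec (row i B')) + (z%:~R - t) *: int_vec v.
    by rewrite -line_lift0 -line_liftD addr0 addrC subrK.
  have [tri _ _] := hrho.
  apply: le_trans (tri _ _) _; rewrite (is_normZ hrho).
  have zt : `|z%:~R - t| <= 2^-1.
    have := Num.Theory.floor_le (t + 2^-1); have := Num.Theory.floorD1_gt (t + 2^-1).
    by rewrite -/z intrD ler_norml => ? ?; apply/andP; split; lra.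
  have := ler_wpM2r (ltW v0) zt; rewrite -/q in ht *; lra.
have [z hz] : {z : 'I_d -> int & forall i,
    rho (line_lift S (z i)%:~R (int_vec (row i B'))) <=
    q (int_vec (row i B')) + 7 / 12 * rho (int_vec v)}.
  exact: boolp.choice hlift.
pose zc : 'cV[int]_d := \col_i z i.
pose B : 'M[int]_(1 + d) := block_mx 1 0 zc B' *m S.
have nB (n0 : 'M[int]_1) (n' : 'rV[int]_d) :
    row_mx n0 n' *m B = row_mx (n0 + n' *m zc) (n' *m B') *m S.
  by rewrite /B mulmxA mul_row_block mulmx1 mulmx0 add0r.
have liftE (a : 'M[int]_1) (y : 'rV[int]_d) :
    int_vec (row_mx a y *m S) = line_lift S (a ord0 ord0)%:~R (int_vec y).
  rewrite int_vecM /line_lift; congr (_ *m _).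
  rewrite /int_vec map_row_mx; congr row_mx.
  by apply/matrixP => i j; rewrite !mxE !ord1 eqxx.
have rowB0 : row (lshift d ord0) B = v.
  rewrite row_mul /block_mx rowKu row_row_mx row0 row1 -[S in LHS]vsubmxK.
  rewrite mul_row_col mul0mx addr0 -rowE.
  by apply/rowP => j; rewrite !mxE; congr (S _ _); apply: val_inj.
have rowBi i : row (rshift 1 i) B = row_mx (z i)%:M (row i B') *m S.
  rewrite row_mul /block_mx rowKd row_row_mx; congr (row_mx _ _ *m _).
  by apply/matrixP => a b; rewrite !mxE !ord1 eqxx.
pose r i := rho (int_vec (row (rshift 1 i) B)).
have rE i : r i = rho (line_lift S (z i)%:~R (int_vec (row i B'))).
  by rewrite /r rowBi liftE mxE eqxx.
have qr i : q (int_vec (row i B')) <= r i by rewrite rE; exact: quotient_norm_le.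
have r0 i : 0 < r i by exact: lt_le_trans (B'0 i) (qr i).
(* Here v being almost shortest enters: its length is at most 3/2 of [r i], and 3/2 times 7/12 is
   7/8, so [r i] is absorbed on the left. *)
have rq i : r i <= 8 * q (int_vec (row i B')).
  have := hz i; rewrite -rE.
  have /hS : row (rshift 1 i) B != 0.
    apply/eqP => ri0; have := r0 i; rewrite /r ri0.
    by rewrite (_ : int_vec 0 = 0) ?is_norm0 ?ltxx//; exact: map_mx0.
  rewrite -/(r i); lra.
have boundq (n0 : 'M[int]_1) (n' : 'rV[int]_d) i :
    k / 8 * `|(n' ord0 i)%:~R| * r i <= rho (int_vec (row_mx n0 n' *m B)).
  apply: (@le_trans _ _ (k * `|(n' ord0 i)%:~R| * q (int_vec (row i B')))).
    rewrite (_ : k / 8 * _ * r i = k * `|(n' ord0 i)%:~R| * (r i / 8)); last by ring.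
    by rewrite ler_wpM2l ?mulr_ge0 ?(ltW k0)// ler_pdivrMr// mulrC.
  apply: le_trans (B'k n' i) _; rewrite nB liftE.
  exact: quotient_norm_le.
have d0 : 0 <= d%:R :> R by [].
have bound0 (n0 : 'M[int]_1) (n' : 'rV[int]_d) :
    k / 8 * (`|(n0 ord0 ord0)%:~R| * rho (int_vec v)) <=
    (k / 8 + d%:R) * rho (int_vec (row_mx n0 n' *m B)).
  set x := int_vec (row_mx n0 n' *m B).
  have xE : (n0 ord0 ord0)%:~R *: int_vec v =
      x - \sum_i (n' ord0 i)%:~R *: int_vec (row (rshift 1 i) B).
    rewrite /x mulmx_sum_row big_split_ord/= big_ord1 rowB0 row_mxEl.
    rewrite /int_vec raddfD/= map_mxZ raddf_sum/=.
    under eq_bigr do rewrite row_mxEr map_mxZ.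
    by rewrite addrK.
  rewrite -(is_normZ hrho) xE.
  have h1 := is_normB_le hrho x (\sum_i (n' ord0 i)%:~R *: int_vec (row (rshift 1 i)
      B)).
  have h2 : k / 8 * rho (\sum_i (n' ord0 i)%:~R *: int_vec (row (rshift 1 i) B)) <=
      d%:R * rho x.
    apply: (@le_trans _ _ (\sum_(i < d) rho x)); last first.
      by rewrite sumr_const card_ord mulr_natl.
    apply: (@le_trans _ _ (\sum_(i < d) k / 8 * (`|(n' ord0 i)%:~R| * r i))).
      rewrite -mulr_sumr ler_pM2l ?divr_gt0//.
      apply: le_trans (is_norm_sum_le hrho _ _ _) _.
      by apply: ler_sum => i _; rewrite (is_normZ hrho).
    by apply: ler_sum => i _; rewrite mulrA; exact: boundq.
  have k8 : 0 < k / 8 by rewrite divr_gt0.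
  have := ler_wpM2l (ltW k8) h1; rewrite mulrDr mulrDl; lra.
have k8 : 0 < k / 8 by rewrite divr_gt0.
have D0 : 0 < k / 8 + d%:R + 1 by lra.
exists B; split.
- move=> l; set m := l *m invmx S.
  have [n' n'E] := B's (rsubmx m).
  exists (row_mx (lsubmx m - n' *m zc) n'); rewrite nB subrK -n'E hsubmxK.
  by rewrite /m mulmxKV.
- move=> i; case: (split_ordP i) => j ->; last exact: r0.
  by rewrite (ord1 j) rowB0.
- move=> n i; rewrite -[n in leRHS]hsubmxK.
  have x0 := is_norm_ge0 hrho (int_vec (row_mx (lsubmx n) (rsubmx n) *m B)).
  case: (split_ordP i) => j ->.
    rewrite (ord1 j) rowB0.
    have := bound0 (lsubmx n) (rsubmx n); rewrite mxE => h.
    set t := _%:~R in h *; rewrite [leLHS](_ : _ =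
      k / 8 * (`|t| * rho (int_vec v)) / (k / 8 + d%:R + 1)); last by ring.
    rewrite ler_pdivrMr//; set u := rho _ in x0 h *; nra.
  rewrite -/(r j).
  have := boundq (lsubmx n) (rsubmx n) j; rewrite mxE => h.
  apply: le_trans h; rewrite -!mulrA ler_wpM2l ?(ltW k0)// ler_wpM2l ?invr_ge0//.
  rewrite ler_piMl ?mulr_ge0 ?(ltW (r0 _))// invf_le1//.
  have : 0 < k / 8 by rewrite divr_gt0.
  lra.
Qed.

Lemma reduced_basis d : exists2 k : R, 0 < k &
  forall rho : 'rV[R]_d -> R, is_norm rho -> exists B, reduced k rho B.
Proof.
elim: d => [|d [k k0 ih]].
  exists 1 => // rho hrho; exists 1; split => [l||n]; last 2 first.
  - by case.
  - by case.
  by exists 0; rewrite !thinmx0.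
have k8 : 0 < k / 8 by rewrite divr_gt0.
exists (k / 8 / (k / 8 + d%:R + 1)).
  by rewrite divr_gt0// ltr_wpDl// addr_ge0// ltW.
move=> rho hrho.
have [//|u u0 hu] := @almost_shortest (1 + d) rho hrho.
have [S uS [z z0 uE]] := primitive_row u0.
have [B' hB'] := ih _ (quotient_is_norm hrho uS).
apply: (reduced_basis_step k0 hrho uS _ hB').
(* [u] is a nonzero integer multiple of the first row of [S], which is thus no longer than [u] and
   almost shortest too. *)
move=> l l0; apply: le_trans (hu l l0).
have -> : int_vec u = z%:~R *: int_vec (row ord0 S) by rewrite uE /int_vec map_mxZ.
rewrite (is_normZ hrho) ler_peMl ?is_norm_ge0// -intr_norm.
by rewrite -[1]/(1%:~R) ler_int; lia.
Qed.

End reduced_basis.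

(** * The gauge of a symmetric convex body *)

Section gauge.
Context {R : realType}.

Lemma convex_setP d (K : set 'rV[R]_d) (x y : 'rV[R]_d) (t : R) :
  convex_set K -> K x -> K y -> 0 <= t -> t <= 1 -> K (t *: x + (1 - t) *: y).
Proof.
move=> cK Kx Ky t0 t1.
by have := cK x y (Itv01 t0 t1); rewrite !inE => /(_ Kx Ky).
Qed.

Definition gauge d (K : set 'rV[R]_d) (x : 'rV[R]_d) : R :=
  inf [set t | 0 < t /\ K (t^-1 *: x)].

Section gauge_theory.
Context d (K : set 'rV[R]_d).
Hypotheses (bK : convex_body K) (sK : origin_symmetric K).

Let E (x : 'rV[R]_d) := [set t | 0 < t /\ K (t^-1 *: x)].

(** If K contains a ball around x0, symmetry gives both x0 + x and x - x0 for small x, and x is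
    their midpoint. *)
Lemma body_ball : exists2 e, 0 < e & forall x, `|x| < e -> K x.
Proof.
case: bK => cK _ [x0]; rewrite /interior/= -nbhs_ballE => -[e /= e0 he].
exists e => // x xe.
have K1 : K (x0 + x) by apply: he; rewrite -ball_normE/= opprD addNKr normrN.
have K2 : K (x - x0).
  rewrite -opprB; apply: sK; apply: he; rewrite -ball_normE/=.
  by rewrite opprB addrC subrK.
have h : 0 <= (2^-1 : R) by rewrite invr_ge0.
have h' : (2^-1 : R) <= 1 by lra.
have := convex_setP cK K1 K2 h h'.
rewrite (_ : 1 - 2^-1 = 2^-1); last by field.
rewrite -scalerDr.
have -> : x0 + x + (x - x0) = 2 *: x by rewrite addrC addrA subrK -mulr2n scaler_nat.
by rewrite scalerA mulVf// scale1r.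
Qed.

Let K0 : K 0.
Proof. by have [e e0 h] := body_ball; apply: h; rewrite normr0. Qed.

Lemma gauge_nonempty x : E x !=set0.
Proof.
have [e e0 h] := body_ball; have x1 : 0 < `|x| + 1 by rewrite ltr_wpDl.
exists ((`|x| + 1) / e); split; first by rewrite divr_gt0.
apply: h; rewrite normrZ gtr0_norm ?invr_gt0 ?divr_gt0// invf_div.
by rewrite mulrAC ltr_pdivrMr// ltr_pM2l//; lra.
Qed.

Lemma has_inf_gauge x : has_inf (E x).
Proof. by split; [exact: gauge_nonempty|exists 0 => t [/ltW]]. Qed.

Lemma gauge_le x t : 0 < t -> K (t^-1 *: x) -> gauge K x <= t.
Proof. by move=> t0 Kt; apply: ge_inf => //; have [] := has_inf_gauge x. Qed.

Lemma gauge_lt x e : gauge K x < e -> exists2 t, t < e & 0 < t /\ K (t^-1 *: x).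
Proof.
move=> xe; have e0 : 0 < e - gauge K x by rewrite subr_gt0.
have [t Et te] := inf_adherent e0 (has_inf_gauge x).
by exists t => //; move: te; rewrite addrC subrK.
Qed.

Lemma gauge_le1 x : K x -> gauge K x <= 1.
Proof. by move=> Kx; apply: gauge_le => //; rewrite invr1 scale1r. Qed.

Lemma gauge_lt1 x : gauge K x < 1 -> K x.
Proof.
move=> /gauge_lt[t t1 [t0 Kt]]; case: bK => cK _ _.
have := convex_setP cK Kt K0 (ltW t0) (ltW t1).
by rewrite scaler0 addr0 scalerA mulfV ?gt_eqF// scale1r.
Qed.

(** Convexity gives the triangle inequality, symmetry the absolute value in homogeneity, and
    boundedness of K the lower bound by coordinates. *)
Lemma gauge_is_norm : is_norm (gauge K).
Proof.
have [cK comK _] := bK; split.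
- move=> x y; apply/ler_addgt0Pr => e e0; have e2 : 0 < e / 2 by lra.
  have [t tx [t0 Kt]] : exists2 t, t < gauge K x + e / 2 & 0 < t /\ K (t^-1 *: x).
    by apply: gauge_lt; rewrite ltrDl.
  have [u uy [u0 Ku]] : exists2 u, u < gauge K y + e / 2 & 0 < u /\ K (u^-1 *: y).
    by apply: gauge_lt; rewrite ltrDl.
  have tu : 0 < t + u by rewrite addr_gt0.
  suff : gauge K (x + y) <= t + u by lra.
  apply: gauge_le => //.
  have h0 : 0 <= t / (t + u) by rewrite divr_ge0 ?ltW.
  have h1 : t / (t + u) <= 1 by rewrite ler_pdivrMr// mul1r lerDl ltW.
  have := convex_setP cK Kt Ku h0 h1.
  rewrite !scalerA scalerDr; congr K; congr (_ *: _ + _ *: _); field.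
    by rewrite !gt_eqF.
  by rewrite !gt_eqF.
- move=> a x; apply/ler_addgt0Pr => e e0.
  have a1 : 0 < `|a| + 1 by rewrite ltr_wpDl.
  have [t tx [t0 Kt]] : exists2 t, t < gauge K x + e / (`|a| + 1) & 0 < t /\ K (t^-1
      *: x).
    by apply: gauge_lt; rewrite ltrDl divr_gt0.
  have h : `|a| * t <= `|a| * gauge K x + e.
    apply: (@le_trans _ _ (`|a| * (gauge K x + e / (`|a| + 1)))).
      by rewrite ler_wpM2l// ltW.
    rewrite mulrDr lerD2l mulrA ler_pdivrMr// mulrC ler_wpM2l ?ltW//; lra.
  apply: le_trans h; have [->|a0] := eqVneq a 0.
    rewrite scale0r normr0 mul0r; apply/ler_addgt0Pr => u u0; rewrite add0r.
    by apply: gauge_le => //; rewrite scaler0.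
  apply: gauge_le; first by rewrite mulr_gt0 ?normr_gt0.
  rewrite scalerA invfM.
  have [ag|al] := ger0P a; first by rewrite mulrAC mulVf// mul1r.
  rewrite invrN !mulNr mulrAC mulVf// mul1r scaleNr.
  exact: sK.
- have [M [_ hM]] := compact_bounded comK.
  pose B := `|M| + 1.
  have B0 : 0 < B by rewrite ltr_wpDl.
  have KB x : K x -> `|x| <= B.
    by apply: hM; rewrite /B; have := ler_norm M; lra.
  exists B^-1; first by rewrite invr_gt0.
  move=> x i; rewrite mulrC ler_pdivrMr//.
  apply: (@le_trans _ _ `|x|).
    rewrite [leRHS]/Num.norm/= mx_normrE.
    exact: (le_bigmax _ (fun ij : 'I_1 * 'I_d => `|x ij.1 ij.2|) (ord0, i)).
  rewrite -ler_pdivrMr//; apply: lb_le_inf; first exact: gauge_nonempty.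
  move=> t [t0 /KB]; rewrite normrZ gtr0_norm ?invr_gt0// => h.
  by rewrite ler_pdivrMr// -ler_pdivrMl.
Qed.

End gauge_theory.
End gauge.

(** * Balanced digit expansions of integers *)

Section digits.

Lemma balanced_digits (h m : nat) (n : int) : (2 * `|n| < (2 * h + 1) ^ m)%N ->
  exists2 k : 'I_m -> int, (forall j, `|k j| <= h)%N &
    n = \sum_j k j * ((2 * h + 1) ^ j)%N%:Z.
Proof.
elim: m n => [|m ih] n nm.
  exists (fun=> 0) => //; rewrite big_ord0; move: nm; rewrite expn0; lia.
pose Q := (2 * h + 1)%N.
pose q := ((n + h%:Z) %/ Q%:Z)%Z; pose r := ((n + h%:Z) %% Q%:Z)%Z - h%:Z.
have nE : n = q * Q%:Z + r.
  by rewrite /r addrA -divz_eq addrK.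
have Q0 : (0 < Q%:Z)%R by rewrite /Q; lia.
have r1 : (- h%:Z <= r)%R by rewrite /r lerBrDl subrr modz_ge0// gt_eqF.
have r2 : (r <= h%:Z)%R by rewrite /r; have := ltz_pmod (n + h%:Z) Q0; rewrite /Q; lia.
have odd_pow : odd (Q ^ m) by rewrite oddX /Q oddD oddM/= orbT.
have qm : (2 * `|q| < Q ^ m)%N.
  move: nm; rewrite expnS -/Q => nm.
  have h1 : (2 * `|q| * Q <= 2 * `|n| + 2 * h)%N.
    have : (`|q| * Q = `|n - r|)%N by rewrite nE addrK abszM.
    lia.
  (* Size alone allows 2|q| = Q^m; parity excludes it, the base being odd. *)
  have h2 : (2 * `|q| < Q ^ m + 1)%N.
    rewrite -(@ltn_pmul2r Q); [rewrite mulnDl|]; move: Q0 h1 nm; rewrite /Q; lia.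
  have : odd (2 * `|q|) = false by rewrite oddM.
  move: odd_pow h2; case: (ltngtP (2 * `|q|)%N (Q ^ m)%N) => //; first by lia.
  by move=> -> ->.
have [k kh qE] := ih q qm.
exists (fun j : 'I_m.+1 => if unlift ord0 j is Some i then k i else r).
  by move=> j; case: unlift => [i|] //; lia.
rewrite big_ord_recl unlift_none/= expn0 mulr1 {1}nE addrC; congr (_ + _).
rewrite {1}qE mulr_suml; apply: eq_bigr => j _.
by rewrite liftK /bump/= add1n expnSr PoszM mulrA.
Qed.

Lemma digits_eq0 (q m : nat) (l : 'I_m -> int) : (forall j, `|l j| < q)%N ->
  \sum_j l j * (q ^ j)%N%:Z = 0 -> forall j, l j = 0.
Proof.
elim: m l => [|m ih] l lq; first by move=> _ [].
rewrite big_ord_recl/= expn0 mulr1.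
rewrite (eq_bigr (fun j : 'I_m => q%:Z * (l (lift ord0 j) * (q ^ j)%N%:Z))); last first.
  by move=> j _; rewrite /bump/= add1n expnS PoszM mulrCA.
rewrite -mulr_sumr; set S := \sum_j _ => lS.
have q0 : (0 < q)%N by apply: leq_ltn_trans (lq ord0).
have l0 : l ord0 = 0.
  have : (`|l ord0| = q * `|S|)%N.
    by rewrite (_ : l ord0 = - (q%:Z * S)) ?abszN ?abszM//; apply/eqP; rewrite
        -addr_eq0 lS.
  have := lq ord0; case: (absz S) => [|s]; first by rewrite muln0; lia.
  by rewrite mulnS; lia.
have S0 : S = 0.
  move: lS; rewrite l0 add0r => /eqP; rewrite mulf_eq0 => /orP[|/eqP//].
  by move/eqP; lia.
move=> j; case: (unliftP ord0 j) => [i ->|->//].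
by apply: (ih (fun i => l (lift ord0 i))) => // i'; exact: lq.
Qed.

End digits.

(** * Lattice points and digits *)

Section lattice_digits.
Context {R : realType}.

(** The number of digits varies with the basis vector: directions in which K is long receive
    more. *)
Definition digit_index d (m : 'I_d -> nat) : Type := {i : 'I_d & 'I_(m i)}.
HB.instance Definition _ d m := Finite.on (@digit_index d m).

Definition digit_vec d (m : 'I_d -> nat) (q : nat) (B : 'M[int]_d)
    (s : digit_index m) : 'rV[int]_d := (q ^ tagged s)%N%:Z *: row (tag s) B.

Lemma sum_digit_vec d (m : 'I_d -> nat) (q : nat) (B : 'M[int]_d)
    (k : digit_index m -> int) :
  \sum_s k s *: digit_vec q B s =
  (\row_i \sum_(j < m i) k (Tagged _ j) * (q ^ j)%N%:Z) *m B.
Proof.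
rewrite mulmx_sum_row.
transitivity (\sum_i \sum_(j < m i) (k (Tagged _ j) * (q ^ j)%N%:Z) *: row i B).
  rewrite (sig_big_dep (fun=> true) (fun _ _ => true))/=.
  by apply: eq_bigr => -[i j] _; rewrite /digit_vec scalerA.
by apply: eq_bigr => i _; rewrite mxE scaler_suml.
Qed.

Lemma card_digit_index d (m : 'I_d -> nat) : #|{: digit_index m}| = (\sum_i m i)%N.
Proof.
transitivity (\sum_i \sum_(j < m i) 1)%N.
  by rewrite (sig_big_dep (fun=> true) (fun _ _ => true))/= -sum1_card.
by apply: eq_bigr => i _; rewrite sum1_card card_ord.
Qed.

Lemma digit_vec_dissociated d (m : 'I_d -> nat) (q : nat) (B : 'M[int]_d)
    (k : R) (rho : 'rV[R]_d -> R) :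
  0 < k -> is_norm rho -> reduced k rho B -> dissociated q (@digit_vec d m q B).
Proof.
move=> k0 hrho [_ B0 Bk] l lq; rewrite sum_digit_vec => n0 [i j].
apply: (@digits_eq0 q (m i) (fun j => l (Tagged _ j))) => [j'|]; first exact: lq.
have := Bk (\row_i \sum_(j < m i) l (Tagged _ j) * (q ^ j)%N%:Z) i.
rewrite n0 (_ : int_vec 0 = 0); last exact: map_mx0.
rewrite (is_norm0 hrho) mxE; set z := \sum_(_ < _) _ => h.
apply/eqP; rewrite -(intr_eq0 R) -normr_le0.
by rewrite -(ler_pM2r (B0 i)) mul0r -(ler_pM2l k0) mulr0 mulrA.
Qed.

Lemma sum_digits_lt (q m : nat) (x : 'I_m -> nat) : (forall j, x j < q)%N ->
  (\sum_j x j * q ^ j < q ^ m)%N.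
Proof.
elim: m x => [|m ih] x xq; first by rewrite big_ord0.
rewrite big_ord_recr/= expnS -{3}(subnK (leq_trans (ltn0Sn _) (xq ord_max))).
rewrite addn1 mulSn.
have h1 := ih (fun j => x (widen_ord (leqnSn m) j)) (fun j => xq _).
have h2 : (x ord_max * q ^ m <= (q - 1) * q ^ m)%N.
  by rewrite leq_mul2r; apply/orP; right; have := xq ord_max; lia.
by rewrite -addSn leq_add.
Qed.

Lemma exists_pow_gt (q : nat) (x : R) : (1 < q)%N -> exists m, x < (q ^ m)%:R.
Proof.
move=> q1; have [m hm] : exists m : nat, x < m%:R.
  exists (Num.bound `|x|); apply: le_lt_trans (ler_norm x) _.
  exact: archi_boundP (normr_ge0 x).
by exists m; rewrite (lt_trans hm)// ltr_nat ltn_expl.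
Qed.

(** The number [m i] of digits is the least with Q^(m i) > 2/(k b_i). Reducedness bounds the i-th
    coordinate on K by 1/(k b_i), so these digits cover K. Conversely, with r + 1 digits fewer per
    direction all expansions fall inside K, which bounds Q^(sum of the m i) by C N with C depending
    on d and h only. *)
Lemma lattice_points_digits d (h : nat) : (0 < h)%N -> exists2 C : nat, (0 < C)%N &
  forall (K : set 'rV[R]_d) (N : nat), convex_body K -> origin_symmetric K ->
    (lattice_points K #= `I_N)%card ->
  exists (T : finType) (w : T -> 'rV[int]_d),
    [/\ dissociated (2 * h + 1) w,
        forall l, lattice_points K l ->
          exists2 k : T -> int, (forall s, `|k s| <= h)%N & l = \sum_s k s *: w s,
        ((2 * h + 1) ^ #|T| <= C * N)%N &
        (N <= (2 * h + 1) ^ #|T|)%N].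
Proof.
move=> h0; set Q := (2 * h + 1)%N.
have Q1 : (1 < Q)%N by rewrite /Q; lia.
have [k k0 red] := @reduced_basis R d.
(* Shortened expansions have d terms of gauge at most (2/k) Q^-r each; this choice makes the sum
   less than 1. *)
have [r hr] := exists_pow_gt (2 * d%:R / k) Q1.
exists (Q ^ (d * r.+1))%N; first by rewrite expn_gt0; lia.
move=> K N bK sK KN.
have hrho := gauge_is_norm bK sK.
have [B hB] := red _ hrho; have [Bs B0 Bk] := hB.
pose b i := gauge K (int_vec (row i B)).
have b0 i : 0 < b i by exact: B0.
have kb0 i : 0 < k * b i by rewrite mulr_gt0.
pose m i := ex_minn (exists_pow_gt (2 / (k * b i)) Q1).
have mP i : 2 / (k * b i) < (Q ^ m i)%:R by rewrite /m; case: ex_minnP.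
have mmin i n : m i = n.+1 -> (Q ^ n)%:R <= 2 / (k * b i).
  rewrite /m; case: ex_minnP => u _ umin un; rewrite leNgt; apply/negP => /umin.
  by rewrite un ltnn.
have cover l : lattice_points K l -> exists2 c : digit_index m -> int,
    (forall s, `|c s| <= h)%N & l = \sum_s c s *: digit_vec Q B s.
  move=> Kl; have [n lE] := Bs l.
  have nQ i : (2 * `|n ord0 i| < Q ^ m i)%N.
    have := Bk n i; rewrite -lE => hn.
    have : k * `|(n ord0 i)%:~R| * b i <= 1 :> R.
      by apply: le_trans hn _; exact: gauge_le1.
    rewrite mulrAC mulrC -ler_pdivlMr// div1r => hn1.
    rewrite -(ltr_nat R); apply: le_lt_trans (mP i).
    have -> : (2 * `|n ord0 i|)%:R = 2 * `|(n ord0 i)%:~R| :> R.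
      by rewrite natrM; congr (_ * _); rewrite pmulrn abszE intr_norm.
    by rewrite ler_pM2l.
  have hdig i := balanced_digits (nQ i).
  have [c ch cE] := fin_all_exists2 hdig.
  exists (fun s => c (tag s) (tagged s)).
    by move=> [i j]; exact: ch.
  rewrite sum_digit_vec lE; congr (_ *m _); apply/rowP => i; rewrite mxE.
  exact: cE.
exists (digit_index m), (@digit_vec d m Q B).
have /card_set_bijP[f [fI finj fsurj]] := KN.
split => //; first exact: digit_vec_dissociated hrho hB.
(* Truncated subtraction: a direction with at most r + 1 digits keeps none and its coordinate is 0.
   Digits are now in [0, Q) rather than balanced. *)
- pose e i := (m i - r.+1)%N.
  have dise := digit_vec_dissociated (m := e) (q := Q) k0 hrho hB.
  pose vec (x : {ffun digit_index e -> 'I_Q}) : 'rV[int]_d :=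
    \sum_s (x s)%:Z *: digit_vec Q B s.
  have Kvec x : lattice_points K (vec x).
    apply: gauge_lt1 bK sK _ _; rewrite -/(int_vec _).
    rewrite /vec sum_digit_vec mulmx_sum_row /int_vec raddf_sum/=.
    apply: le_lt_trans (is_norm_sum_le hrho _ _ _) _.
    apply: (@le_lt_trans _ _ (\sum_(i < d) 2 / k / (Q ^ r)%:R)).
      apply: ler_sum => i _; rewrite map_mxZ (is_normZ hrho) -/(int_vec _) -/(b i) mxE.
      set n := (\sum_(j < e i) x (Tagged _ j) * Q ^ j)%N.
      have -> : \sum_(j < e i) (x (Tagged _ j))%:Z * (Q ^ j)%N%:Z = n%:Z.
        by rewrite -[RHS]natz natr_sum; apply: eq_bigr => j _; rewrite natz PoszM.
      have nQ : (n < Q ^ e i)%N by apply: sum_digits_lt => j; exact: ltn_ord.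
      rewrite /= -pmulrn normr_nat.
      have Qr0 : 0 < (Q ^ r)%:R :> R by rewrite ltr0n expn_gt0; lia.
      case mi : (m i) => [|u].
        move: nQ; rewrite /e mi sub0n expn0 ltnS leqn0 => /eqP ->.
        by rewrite mul0r !divr_ge0// ltW.
      have [ur|ru] := leqP u r.
        move: nQ; rewrite /e mi subSS (eqP (_ : u - r == 0)%N) ?expn0; last by lia.
        rewrite ltnS leqn0 => /eqP ->.
        by rewrite mul0r !divr_ge0// ltW.
      have := mmin _ _ mi; rewrite invfM mulrA ler_pdivlMr// => hu.
      rewrite ler_pdivlMr//; apply: le_trans hu.
      rewrite mulrAC ler_wpM2r ?(ltW (b0 i))// -natrM ler_nat.
      rewrite -(subnK (ltnW ru)) expnD leq_mul2r.
      by move: nQ; rewrite /e mi subSS => /ltnW ->; rewrite orbT.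
    rewrite sumr_const card_ord .
    have Qr0 : 0 < (Q ^ r)%:R :> R by rewrite ltr0n expn_gt0; lia.
    rewrite -[X in X < _]mulr_natl mulrA ltr_pdivrMr// mul1r; apply: le_lt_trans hr.
    by rewrite mulrA [d%:R * 2]mulrC.
  have vec_inj : injective vec.
    move=> x y /eqP; rewrite -subr_eq0 /vec -sumrB => /eqP xy.
    have /(_ _ _) := dise (fun s => (x s)%:Z - (y s)%:Z); move=> h1.
    apply/ffunP => s; apply: val_inj => /=.
    have : (x s)%:Z - (y s)%:Z = 0.
      apply: h1 => [u|]; first by have := ltn_ord (x u); have := ltn_ord (y u); lia.
      by rewrite -[RHS]xy; apply: eq_bigr => u _; rewrite scalerBl.
    lia.
  have : (Q ^ (\sum_i e i) <= N)%N.
    have -> : (Q ^ (\sum_i e i))%N = size (map (f \o vec) (enum {ffun digit_index e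
        -> 'I_Q})).
      by rewrite size_map -cardE card_ffun card_ord card_digit_index.
    rewrite -[leqRHS](size_iota 0); apply: uniq_leq_size.
      rewrite map_inj_uniq ?enum_uniq// => x y /= fxy; apply: vec_inj.
      by apply: finj; rewrite ?inE//; exact: Kvec.
    move=> _ /mapP[x _ ->]; rewrite mem_iota add0n /=.
    exact: fI (Kvec x).
  move=> eN; rewrite card_digit_index.
  apply: leq_trans (leq_mul (leqnn _) eN); rewrite -expnD leq_exp2l; last exact: Q1.
  apply: (@leq_trans (\sum_(i < d) (r.+1 + e i))%N).
    by apply: leq_sum => i _; rewrite /e; lia.
  by rewrite big_split/= sum_nat_const card_ord.
(* Balanced digits shifted by h become ordinals below Q, and covering makes [g] hit every index
   below N. *)
- pose g (x : {ffun digit_index m -> 'I_Q}) :=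
    f (\sum_s ((x s)%:Z - h%:Z) *: digit_vec Q B s).
  have -> : (Q ^ #|{: digit_index m}|)%N = size (map g (enum {ffun digit_index m ->
      'I_Q})).
    by rewrite size_map -cardE card_ffun card_ord.
  rewrite -[leqLHS](size_iota 0); apply: uniq_leq_size; first exact: iota_uniq.
  move=> i; rewrite mem_iota add0n /= => iN.
  have [l Kl <-] := fsurj i iN; have [c ch ->] := cover l Kl.
  have cQ s : (absz (c s + h%:Z)%R < Q)%N by have := ch s; rewrite /Q; lia.
  apply/mapP; exists [ffun s => Ordinal (cQ s)]; first by rewrite mem_enum.
  rewrite /g; congr f; apply: eq_bigr => s _; rewrite ffunE/=; congr (_ *: _).
  by have := ch s; lia.
Qed.

End lattice_digits.

(** * Widths *)

Section width.
Context {R : realType} (d : nat).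
Implicit Types f g : d.-tuple R -> R[i].

Lemma torus_Lnorm_ae_eq (p : R) f g : complex_measurable f -> complex_measurable g ->
  torus_ae_eq f g -> torus_Lnorm p f = torus_Lnorm p g.
Proof.
move=> mf mg fg; rewrite /torus_Lnorm unlock; congr (_ `^ _)%E.
have m h : complex_measurable h ->
    measurable_fun setT (fun y : d.-tuple R => (`|(cabs (h y))%:E| `^ p)%E).
  move=> mh; apply: (eq_measurable_fun (fun y => (cabs (h y) `^ p)%:E)).
    by move=> y _; rewrite gee0_abs ?lee_fin ?cabs_ge0// poweR_EFin.
  apply: measurableT_comp => //.
  exact: (measurableT_comp (measurable_powR _) (measurable_cabs mh)).
apply: ae_eq_integral => //; [exact: m|exact: m|].
by apply: filterS fg => y h /h ->.
Qed.

(** The span is saturated under almost everywhere equality, since [Lp_subspace] requires it of sets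
    of representatives. *)
Definition ae_span (p : R) m (b : 'I_m -> d.-tuple R -> R[i]) :
    set (d.-tuple R -> R[i]) :=
  [set f | torus_Lp p f /\ exists c, torus_ae_eq f (lincomb c b)].

(** A sum has finite norm because it agrees almost everywhere with a bounded combination of the b_i;
    Minkowski's inequality is avoided. *)
Lemma ae_span_subspace (p : R) m (b : 'I_m -> d.-tuple R -> R[i]) :
  1 <= p -> (forall i, torus_bounded (b i)) -> Lp_subspace p (ae_span p b).
Proof.
move=> p1 hb; split.
- by move=> f [].
- move=> f g [_ [c fc]] gp fg; split => //; exists c.
  by apply: filterS2 fg fc => y h1 h2 _; rewrite -h1// h2.
- split; first by apply: torus_bounded_Lp => //; exact: torus_bounded_cst.
  exists (fun=> 0); apply: aeW => y _.
  by rewrite /lincomb big1// => i _; rewrite mul0r.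
- move=> a f g [[pf mf _] [c fc]] [[pg mg _] [e ge]].
  have cfg : torus_ae_eq (fun x => a * f x + g x) (lincomb (fun i => a * c i + e i) b).
    apply: filterS2 fc ge => y h1 h2 _; rewrite h1// h2// /lincomb mulr_sumr -big_split.
    by apply: eq_bigr => i _; rewrite mulrDl mulrA.
  split; last by exists (fun i => a * c i + e i).
  have hl : torus_bounded (lincomb (fun i => a * c i + e i) b).
    exact: torus_bounded_lincomb.
  have mc : complex_measurable (fun x => a * f x + g x).
    have [mf1 mf2] := mf; have [mg1 mg2] := mg; split.
      rewrite (_ : (fun x => _) = (fun x => complex.Re a * complex.Re (f x) -
          complex.Im a * complex.Im (f x) + complex.Re (g x))).
        apply: measurable_funD => //; apply: measurable_funB; apply: measurable_funM
            => //;
          exact: measurable_cst.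
      by apply/funext => x; case: (a) (f x) (g x) => [? ?] [? ?] [? ?].
    rewrite (_ : (fun x => _) = (fun x => complex.Re a * complex.Im (f x) +
        complex.Im a * complex.Re (f x) + complex.Im (g x))).
      apply: measurable_funD => //; apply: measurable_funD; apply: measurable_funM =>
          //;
        exact: measurable_cst.
    by apply/funext => x; case: (a) (f x) (g x) => [? ?] [? ?] [? ?].
  split => //.
    by move=> x k; rewrite pf pg.
  have [_ ml lfin] := torus_bounded_Lp p1 hl.
  by rewrite (torus_Lnorm_ae_eq p mc ml cfg).
Qed.

Definition ae_spans (V : set (d.-tuple R -> R[i])) (m : nat) : Prop :=
  exists b : 'I_m -> d.-tuple R -> R[i],
    (forall i, V (b i)) /\ forall f, V f -> exists c, torus_ae_eq f (lincomb c b).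

Lemma lincomb_lift m (c : 'I_m.+1 -> R[i]) (b : 'I_m.+1 -> d.-tuple R -> R[i]) i x :
  lincomb c b x = c i * b i x +
    lincomb (fun j => c (lift i j)) (fun j => b (lift i j)) x.
Proof. by rewrite /lincomb (bigD1_ord i). Qed.

(* A spanning family of minimal length is a basis. *)
Lemma ae_spans_dim (V : set (d.-tuple R -> R[i])) m :
  ae_spans V m -> exists2 m', (m' <= m)%N & Lp_dim V m'.
Proof.
move=> Vm; have ex : exists m', `[< ae_spans V m' >] by exists m; apply/asboolP.
case: (ex_minnP ex) => m' /asboolP[b [Vb bV]] m'min.
exists m'; first by apply: m'min; apply/asboolP.
exists b; split => // c c0 i; apply: contrapT => /eqP ci.
case: m' b m'min Vb bV c c0 i ci => [? ? ? ? ? ? []//|m'] b m'min Vb bV c c0 i ci.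
suff /asboolP/m'min : ae_spans V m' by rewrite ltnn.
exists (fun j => b (lift i j)); split => // f /bV[e fe].
exists (fun j => e (lift i j) - e i / c i * c (lift i j)).
apply: filterS2 fe c0 => y h1 h2 _; rewrite h1// (lincomb_lift e b i).
have := h2 Logic.I; rewrite (lincomb_lift c b i) => h.
have bi : b i y = - (c i)^-1 * lincomb (fun j => c (lift i j)) (fun j => b (lift i
    j)) y.
  apply: (mulfI ci); move/eqP: h; rewrite addr_eq0 => /eqP ->.
  by rewrite mulNr mulrN mulrA divff// mul1r.
rewrite bi /lincomb !mulr_sumr -big_split; apply: eq_bigr => j _ /=; ring.
Qed.

(** The given functions may be dependent; passing to a minimal spanning family can only lower the
    dimension. *)
Lemma kolmogorov_width_le (n p : R) (A : set (d.-tuple R -> R[i])) (e : \bar R)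
    m (b : 'I_m -> d.-tuple R -> R[i]) :
  1 <= p -> m%:R <= n -> (forall i, torus_bounded (b i)) ->
  (forall f, A f -> exists c, (torus_Lnorm p (fun x => f x - lincomb c b x)%R <=
      e)%E) ->
  (kolmogorov_width n A p <= e)%E.
Proof.
move=> p1 mn hb Ab.
have bV i : ae_span p b (b i).
  split; first exact: torus_bounded_Lp.
  exists (fun j => (j == i)%:R); apply: aeW => y _.
  rewrite /lincomb (bigD1 i)//= eqxx mul1r big1 ?addr0// => j /negbTE ->.
  by rewrite mul0r.
have [m' m'm Vm'] : exists2 m', (m' <= m)%N & Lp_dim (ae_span p b) m'.
  by apply: ae_spans_dim; exists b; split => // f [].
apply: ge_ereal_inf.
exists (ereal_sup [set Lp_dist p f (ae_span p b) | f in A]).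
  exists (ae_span p b) => //; split; first exact: ae_span_subspace.
  by exists m' => //; rewrite (le_trans _ mn)// ler_nat.
apply: ge_ereal_sup => _ [f Af <-]; have [c hc] := Ab f Af.
apply: ge_ereal_inf; exists (torus_Lnorm p (fun x => f x - lincomb c b x)%R) => //.
exists (lincomb c b) => //; split.
  by apply: torus_bounded_Lp => //; exact: torus_bounded_lincomb.
by exists c; apply: aeW.
Qed.

End width.

(** * Choice of the parameters *)

Section parameters.
Context {R : realType}.

Lemma powR_exprn (x a : R) n : 0 <= x -> (x `^ a) ^+ n = (x ^+ n) `^ a.
Proof.
move=> x0; rewrite -(powR_mulrn n (powR_ge0 x a)) -(powR_mulrn n x0).
exact: powRAC.
Qed.

(** One factor sqrt(tau) pays for replacing 2^l by q, the other is at most q^(-2a), so 2^l tau <=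
    q^(1 - 2a). Its n-th power is at most C N^(1 - 2a), and one of the two factors N^(-a) is spent
    on the constant 3 l C. *)
Lemma rank_bound (tau a : R) (N n l q C : nat) :
  0 < tau -> 0 <= a -> a <= 4^-1 -> (0 < N)%N -> (1 < q)%N -> (0 < C)%N ->
  (2 ^ l)%:R * Num.sqrt tau <= q%:R -> a * (4 * ln q%:R) <= - ln tau ->
  (q ^ n <= C * N)%N -> 3 * l%:R * C%:R <= N%:R `^ a ->
  l%:R * (3 * (2 * tau) ^+ n) * ((2 ^ l) ^ n)%:R / (2 ^ n)%:R <= N%:R `^ (1 - a).
Proof.
move=> tau0 a0 a4 N0 q1 C0 hq ha hC hN.
have p0 : 2%:R ^+ n != 0 :> R by rewrite expf_neq0.
have -> : l%:R * (3 * (2 * tau) ^+ n) * ((2 ^ l) ^ n)%:R / (2 ^ n)%:R =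
    3 * l%:R * ((2 ^ l)%:R * tau) ^+ n.
  by rewrite !natrX !exprMn; field.
set st := Num.sqrt tau in hq *.
have st0 : 0 < st by rewrite sqrtr_gt0.
have stt : tau = st * st by rewrite -expr2 sqr_sqrtr// ltW.
have qR : 0 < q%:R :> R by rewrite ltr0n; lia.
have lq : 0 < ln q%:R :> R by rewrite ln_gt0// ltr1n.
have NR : 0 < N%:R :> R by rewrite ltr0n.
have CR : 1 <= C%:R :> R by rewrite ler1n.
have hst : st <= q%:R `^ (- (2 * a)).
  rewrite /powR gt_eqF// -[leLHS]lnK ?posrE// ler_expR.
  have : ln tau = ln st + ln st by rewrite stt lnM ?posrE.
  lra.
have h1 : (2 ^ l)%:R * tau <= q%:R `^ (1 - 2 * a).
  rewrite stt mulrA powRD; last by rewrite (gt_eqF qR) implybT.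
  rewrite powRr1 ?(ltW qR)//; apply: ler_pM => //; last exact: ltW.
  by rewrite mulr_ge0// ltW.
have h2 : ((2 ^ l)%:R * tau) ^+ n <= C%:R * N%:R `^ (1 - 2 * a).
  apply: (@le_trans _ _ ((q%:R `^ (1 - 2 * a)) ^+ n)).
    by rewrite lerXn2r ?nnegrE ?powR_ge0// mulr_ge0// ltW.
  rewrite powR_exprn ?(ltW qR)// -natrX.
  apply: (@le_trans _ _ ((C * N)%:R `^ (1 - 2 * a))).
    by apply: ge0_ler_powR; rewrite ?nnegrE ?ler_nat//; lra.
  rewrite natrM powRM// ler_wpM2r ?powR_ge0//.
  by rewrite -[leRHS]powRr1 ?ler_powR//; lra.
apply: (@le_trans _ _ (3 * l%:R * (C%:R * N%:R `^ (1 - 2 * a)))).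
  by rewrite ler_wpM2l// mulr_ge0.
rewrite mulrA (_ : 1 - a = a + (1 - 2 * a)); last by ring.
rewrite powRD; last by rewrite (gt_eqF NR) implybT.
by rewrite ler_wpM2r ?powR_ge0.
Qed.

(** For X = 2^(ln) one has N <= X <= q^(2n) <= (C N)^2 <= N^4. The negative power of X is estimated
    by X >= N, the surplus X^(2 eps) by X <= N^4, whence 8 eps. *)
Lemma error_bound (eps p : R) (N n l v q C : nat) :
  0 < eps -> 1 <= p -> p < 2 -> (0 < N)%N ->
  (N <= q ^ n)%N -> (q <= 2 ^ l)%N -> (2 ^ l <= q ^ 2)%N ->
  (q ^ n <= C * N)%N -> (C <= N)%N -> v%:R <= eps * l%:R ->
  (expR (ln 2 * (2^-1 + eps)) ^+ n) ^+ l * (2 ^ v)%:R ^+ n *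
    ((2 ^ l)%:R ^+ n) `^ (- p^-1) <= N%:R `^ (- (p^-1 - 2^-1) + 8 * eps).
Proof.
move=> e0 p1 p2 N0 Nq ql lq qC CN vl.
set X : R := (2 ^ l)%:R ^+ n.
have X0 : 0 < X by rewrite exprn_gt0// ltr0n expn_gt0.
have NR : 0 < N%:R :> R by rewrite ltr0n.
have E1 : (expR (ln 2 * (2^-1 + eps)) ^+ n) ^+ l = X `^ (2^-1 + eps).
  have -> : expR (ln 2 * (2^-1 + eps)) = 2 `^ (2^-1 + eps).
    by rewrite /powR pnatr_eq0 mulrC.
  by rewrite !powR_exprn ?exprn_ge0// exprAC -natrX.
have E2 : (2 ^ v)%:R ^+ n <= X `^ eps.
  rewrite -powR_exprn// lerXn2r ?nnegrE ?powR_ge0//.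
  rewrite !natrX -!powR_mulrn// -powRrM; apply: ler_powR; first by rewrite ler1n.
  by rewrite mulrC.
have mono i j k : (i <= j -> i ^ k <= j ^ k)%N.
  by move=> ij; elim: k => // k ih; rewrite !expnS leq_mul.
have E3 : N%:R <= X.
  by rewrite /X -natrX ler_nat (leq_trans Nq)// mono.
have E4 : X <= N%:R ^+ 4.
  rewrite /X -!natrX ler_nat.
  have h1 : ((2 ^ l) ^ n <= (q ^ n) ^ 2)%N.
    by rewrite [leqRHS]expnAC mono.
  apply: leq_trans h1 _; rewrite (expnM N 2 2); apply: mono.
  by apply: leq_trans qC _; rewrite expnS expn1 leq_mul2r CN orbT.
apply: (@le_trans _ _ (X `^ (- (p^-1 - 2^-1) + 2 * eps))).
  rewrite E1 (_ : - (p^-1 - 2^-1) + 2 * eps = 2^-1 + eps + eps - p^-1); last by ring.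
  have Xn : X != 0 by rewrite gt_eqF.
  rewrite [leRHS]powRD ?Xn ?implybT// [X in _ <= X * _]powRD ?Xn ?implybT//.
  by rewrite ler_wpM2r ?powR_ge0// ler_wpM2l ?powR_ge0.
have pp : 2^-1 <= p^-1 by rewrite lef_pV2 ?posrE//; lra.
rewrite powRD ?(gt_eqF X0) ?implybT// powRD ?(gt_eqF NR) ?implybT//.
apply: ler_pM; rewrite ?powR_ge0//.
  rewrite !powRN lef_pV2 ?posrE ?powR_gt0//.
  by apply: ge0_ler_powR; rewrite ?nnegrE ?subr_ge0// ltW.
apply: (@le_trans _ _ ((N%:R ^+ 4) `^ (2 * eps))).
  by apply: ge0_ler_powR; rewrite ?nnegrE ?exprn_ge0 ?(ltW X0)//; lra.
rewrite -powR_mulrn ?(ltW NR)// -powRrM le_eqVlt; apply/orP; left; apply/eqP.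
by congr (_ `^ _); ring.
Qed.

(** The proportion of unserved frequencies is at most g/2^l = 2^-v, so 2^v >= 1/(1 - st) suffices
    for the last bound, and 2^v >= 4 gives g <= h. Scaling g and h by 2^u then raises l without
    changing v, until v <= eps l. *)
Lemma choose_scales (eps st : R) : 0 < eps -> st < 1 ->
  exists l g h v : nat,
    [/\ (0 < g)%N, (g <= h)%N, (2 ^ l = h + g + h)%N, (2 ^ l = g * 2 ^ v)%N &
        v%:R <= eps * l%:R] /\ (2 ^ l)%:R * st <= (2 * h + 1)%:R.
Proof.
move=> eps0 st1.
have [v [v4 hv]] : exists v, (4 <= 2 ^ v)%N /\ (1 - st)^-1 <= (2 ^ v)%:R.
  have [v0 hv0] := exists_pow_gt (1 - st)^-1 (isT : (1 < 2)%N).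
  exists v0.+2; split; first by rewrite -[4%N]/(2 ^ 2)%N leq_exp2l.
  by rewrite (le_trans (ltW hv0))// ler_nat leq_exp2l// -addn2 leq_addr.
have [u hu] : exists u : nat, v%:R / eps <= u%:R.
  by exists (Num.bound (v%:R / eps)); apply/ltW/archi_boundP; rewrite divr_ge0// ltW.
have u1 : (1 <= 2 ^ u)%N by rewrite expn_gt0.
pose g := (2 * 2 ^ u)%N; pose h := (2 ^ u * (2 ^ v - 1))%N.
have gE : (2 ^ (v + u.+1) = g * 2 ^ v)%N by rewrite expnD expnS mulnC.
have lE : (g * 2 ^ v = h + g + h)%N.
  rewrite /g /h; move: (2 ^ u)%N (2 ^ v)%N v4 => P [//|V] _.
  by rewrite subn1 /= mulnS -mulnA; lia.
exists (v + u.+1)%N, g, h, v; split; first split.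
- by rewrite muln_gt0.
- by rewrite /g /h mulnC leq_mul2l leq_subRL ?(leq_trans _ v4)// orbT.
- by rewrite gE lE.
- exact: gE.
- rewrite -ler_pdivrMl// mulrC (le_trans hu)// ler_nat.
  by rewrite (leq_trans (leqnSn u))// leq_addl.
have st2 : 1 <= (2 ^ v)%:R * (1 - st) by rewrite -ler_pdivrMr ?subr_gt0// div1r.
have gR : g%:R <= (2 ^ (v + u.+1))%:R * (1 - st).
  by rewrite gE natrM -mulrA ler_peMr.
have : (2 ^ (v + u.+1))%:R = (2 * h + 1)%:R + g%:R - 1 :> R.
  by rewrite gE lE !natrD natrM; ring.
have : 1 <= g%:R :> R by rewrite ler1n muln_gt0.
lra.
Qed.

Lemma scale_bounds (g h M : nat) : (0 < g)%N -> (g <= h)%N -> M = (h + g + h)%N ->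
  [/\ (0 < h)%N, (1 < 2 * h + 1)%N, (2 * h + 1 <= M)%N & (M <= (2 * h + 1) ^ 2)%N].
Proof.
by move=> g0 gh ->; rewrite expnS expn1; split; lia.
Qed.

End parameters.

Theorem proposition1p6 (R : realType) (eta : R) (eta_gt0 : 0 < eta) :
  exists2 a : R, 0 < a &
  forall d : nat, (1 <= d)%N ->
  exists N0 : nat,
  forall (p : R) (K : set 'rV[R]_d) (N : nat),
    1 <= p -> p < 2 ->
    convex_body K -> origin_symmetric K ->
    (lattice_points K #= `I_N)%card -> (N0 <= N)%N ->
    (kolmogorov_width (N%:R `^ (1 - a)) (torus_exps (lattice_points K)) p
       <= (N%:R `^ (- (p^-1 - 2^-1) + eta))%:E)%E.
Proof.
pose eps := eta / 8.
have eps0 : 0 < eps by rewrite divr_gt0.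
have l2 : 0 < ln 2 :> R by rewrite ln_gt0// ltr1n.
have hb : ln 2 / 2 < ln 2 * (2^-1 + eps).
  by rewrite ltr_pM2l// ltrDl.
have [tau [tau0 tau1 had]] := hadamard_approximable hb.
set st := Num.sqrt tau.
have st1 : st < 1 by rewrite -sqrtr1 ltr_sqrt.
have [l [g [h [v [[g0 gh lE gv vl] hq]]]]] := choose_scales eps0 st1.
have [h0 q1 ql lq] := scale_bounds g0 gh lE.
have Mg : (2 ^ l)%:R / g%:R = (2 ^ v)%:R :> R.
  by rewrite gv natrM mulrAC mulfV ?mul1r// pnatr_eq0 -lt0n.
have lnq : 0 < ln (2 * h + 1)%:R :> R by rewrite ln_gt0// ltr1n.
have lntau : ln tau < 0 by apply: ln_lt0; rewrite tau0 tau1.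
(* All ingredients come from eta through [tau] and [h], before d, p and K are introduced; d enters
   only the constant [C] below. *)
pose a : R := Num.min 4^-1 (- ln tau / (4 * ln (2 * h + 1)%:R)).
have a0 : 0 < a.
  rewrite lt_min invr_gt0 ltr0n/= divr_gt0 ?mulr_gt0//; lra.
have a4 : a <= 4^-1 by rewrite ge_min lexx.
have aq : a * (4 * ln (2 * h + 1)%:R) <= - ln tau.
  by rewrite -ler_pdivlMr ?mulr_gt0// ge_min lexx orbT.
exists a => // d _.
have [C C0 lat] := @lattice_points_digits R d h h0.
pose x : R := 3 * l%:R * C%:R.
have x0 : 0 <= x by rewrite !mulr_ge0.
(* The first bound gives C <= N for the error, the second 3 l C <= N^a for the rank. *)
exists (maxn C.+1 (Num.bound (x `^ a^-1))) => p K N p1 p2 bK sK KN.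
rewrite geq_max => /andP[CN xN].
have [T [w [dis cover qC Nq]]] := lat K N bK sK KN.
have N0 : (0 < N)%N by exact: leq_ltn_trans CN.
have hN : x <= N%:R `^ a.
  have -> : x = (x `^ a^-1) `^ a by rewrite -powRrM mulVf ?gt_eqF// powRr1.
  apply: ge0_ler_powR; rewrite ?nnegrE ?powR_ge0 ?(ltW a0)//.
  by apply: le_trans (ltW (archi_boundP (powR_ge0 _ _))) _; rewrite ler_nat.
have [m [b [mr bb hap]]] :=
  torus_approximation g0 gh lE dis (fourier_approximable (had T) l).
apply: (kolmogorov_width_le p1 _ bb).
  apply: le_trans mr _; exact: (rank_bound tau0 (ltW a0) a4 N0 q1 C0 hq aq qC hN).
move=> _ [k /cover[c ch ->] <-]; have [c' hc'] := hap c ch.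
exists c'; apply: le_trans (hc' p p1) _; rewrite lee_fin Mg.
rewrite (_ : eta = 8 * eps); last by rewrite /eps; field.
exact: (error_bound eps0 p1 p2 N0 Nq ql lq qC (ltnW CN) vl).
Qed.
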